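(* Let $n\ge 2$ be an integer and let $q>n$ be a real number. Then there exist origin-symmetric convex bodies $K$ and $L$ in $\mathbb{R}^n$ such that $\widetilde{C}_q(K,\cdot)=\widetilde{C}_q(L,\cdot)$ as Borel measures on $\mathbb{S}^{n-1}$, while $K\neq L$.
   Context: A convex body in $\mathbb{R}^n$ is a compact convex set with non-empty interior; it is origin-symmetric if $K=-K$. For a convex body $K$ with the origin in its interior, its radial function is $\rho_K(x)=\sup\{\lambda\ge 0:\lambda x\in K\}$, $x\in\mathbb{R}^n\setminus\{0\}$. For $q\in\mathbb{R}$, the $q$-th dual curvature measure of $K$ is the Borel measure on the unit sphere $\mathbb{S}^{n-1}$ given by $$\widetilde{C}_q(K,\eta)=\frac1n\int_{\alpha_K^*(\eta)}\rho_K^q(u)\,du,\qquad \eta\subset\mathbb{S}^{n-1}\text{ Borel},$$ where $du$ is spherical Lebesgue measure and $\alpha_K^*(\eta)$ is the set of $u\in\mathbb{S}^{n-1}$ such that the boundary point $\rho_K(u)u$ of $K$ has an outer unit normal vector belonging to $\eta$. *)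

(* Defs.v *)
From HB Require Import structures.
From mathcomp Require Import all_boot all_order all_algebra.
From mathcomp Require Import all_classical all_reals all_analysis.
From mathcomp Require Import measurable_realfun.

Set Implicit Arguments.
Unset Strict Implicit.
Unset Printing Implicit Defensive.

Import Order.TTheory GRing.Theory Num.Theory.
Import numFieldNormedType.Exports.

Local Open Scope classical_set_scope.
Local Open Scope ring_scope.

(* 'rV[R]_n carries the Borel sigma-algebra of its topology. The library norm
   `|x| on 'rV[R]_n is the sup norm; it induces the usual topology, and the
   Euclidean norm is [enorm] below. *)
Definition borel_rV_display : measure_display.
Proof. exact. Qed.

Section borel_rV.
Context {R : realType} {n : nat}.

HB.instance Definition _ :=
  @isMeasurable.Build borel_rV_display 'rV[R]_n
    <<s (@open 'rV[R]_n) >> (@sigma_algebra0 _ setT (@open 'rV[R]_n))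
    (@sigma_algebraC _ (@open 'rV[R]_n))
    (@sigma_algebra_bigcup _ setT (@open 'rV[R]_n)).

Lemma open_measurable_rV (U : set 'rV[R]_n) : open U -> measurable U.
Proof. exact: sub_sigma_algebra. Qed.

Lemma measurable_coord (i : 'I_n) :
  measurable_fun [set: 'rV[R]_n] (fun x : 'rV[R]_n => (x ord0 i : R)).
Proof.
apply: (measurability _ (RGenOpens.measurableE R)).
move=> _ [_ [a [b ->] <-]]; rewrite setTI; apply: open_measurable_rV.
apply: open_comp; last exact: interval_open.
by move=> x _; exact: coord_continuous.
Qed.

Lemma open_rV_bigcup (U : set 'rV[R]_n) : open U ->
  U = \bigcup_(q in [set q : 'rV[rat]_n * nat |
         ball (map_mx ratr q.1 : 'rV[R]_n) q.2.+1%:R^-1 `<=` U])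
      ball (map_mx ratr q.1 : 'rV[R]_n) q.2.+1%:R^-1.
Proof.
move=> oU; apply/seteqP; split; last by move=> x [q /= qU /qU].
move=> x Ux.
have /nbhs_ballP[e /= e0 eU] : nbhs x U by exact: open_nbhs_nbhs.
have [k ke] : exists k : nat, k.+1%:R^-1 < e / 2.
  have /ltr_add_invr[k] : 0 < e / 2 by rewrite divr_gt0.
  by rewrite add0r; exists k.
pose d : R := k.+1%:R^-1.
have d0 : 0 < d by rewrite invr_gt0.
have Hq i : exists q : rat, ball (x ord0 i : R) d (ratr q).
  have /rat_in_itvoo[q] : x ord0 i - d < x ord0 i + d.
    by rewrite (lt_trans (y := x ord0 i)) ?gtrBl ?ltrDl.
  rewrite in_itv /= => qI; exists q.
  by rewrite /ball /= distrC ltr_distl.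
have [q qP] := choice Hq.
have xq : ball (map_mx ratr (\row_i q i) : 'rV[R]_n) d x.
  split => // i j; rewrite !mxE ord1; exact/ball_sym/qP.
exists (\row_i q i, k) => //= y /= qy; apply: eU.
apply: le_ball (ball_triangle (ball_sym xq) qy).
by rewrite -/d (splitr e) lerD// ltW.
Qed.

End borel_rV.

Section measurable_to_rV.
Context {R : realType} {d : measure_display} {T : measurableType d} {n : nat}.

Lemma measurable_fun_rV (f : T -> 'rV[R]_n) :
  (forall i, measurable_fun [set: T] (fun t => f t ord0 i : R)) ->
  measurable_fun [set: T] f.
Proof.
move=> mf; apply: (@measurability _ _ _ _ setT f (@open 'rV[R]_n)) => //.
move=> _ [U oU <-]; rewrite setTI (open_rV_bigcup oU) preimage_bigcup.
rewrite bigcup_mkcond; apply: countable_bigcupT_measurable => // q.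
case: ifPn => // _; set c := map_mx _ _; set r := q.2.+1%:R^-1.
rewrite (_ : _ @^-1` _ = \bigcap_(i in [set: 'I_n])
    ((fun t => f t ord0 i : R) @^-1` ball (c ord0 i : R) r)).
  apply: fin_bigcap_measurable => // i _.
  rewrite -[X in measurable X]setTI; apply: mf => //.
  exact: measurable_ball.
apply/seteqP; split=> t /=; first by move=> [_ ft] i _; exact: ft.
move=> ft; split; first by rewrite invr_gt0.
by move=> i j; rewrite ord1; exact: ft.
Qed.

End measurable_to_rV.

Section lebesgue_rV.
Context {R : realType}.

Definition rV_cons {n} (p : measurableTypeR R * 'rV[R]_n) : 'rV[R]_n.+1 := row_mx (p.1 : R)%:M p.2.

Definition rV_uncons {n} (x : 'rV[R]_n.+1) : measurableTypeR R * 'rV[R]_n :=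
  (x ord0 ord0, rsubmx (x : 'rV[R]_(1 + n))).

Lemma rV_consK n : cancel (@rV_cons n) rV_uncons.
Proof.
move=> [a y]; rewrite /rV_uncons /rV_cons /= row_mxKr; congr pair.
by rewrite mxE; case: splitP => // j; rewrite ord1 mxE eqxx.
Qed.

Lemma measurable_rV_cons n : measurable_fun [set: measurableTypeR R * 'rV[R]_n] rV_cons.
Proof.
apply: measurable_fun_rV => i; rewrite /rV_cons.
have [j ->|j ->] := split_ordP (i : 'I_(1 + n)).
  rewrite [X in measurable_fun _ X](_ : _ = fst)//.
  apply/funext => p /=; apply: etrans (row_mxEl _ _ _ _) _.
  by rewrite mxE (ord1 j).
rewrite [X in measurable_fun _ X](_ : _ =
    (fun x : 'rV[R]_n => x ord0 j : R) \o snd).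
  by apply: measurableT_comp => //; exact: measurable_coord.
by apply/funext => p /=; exact: row_mxEr.
Qed.

Lemma measurable_rV_uncons n : measurable_fun [set: 'rV[R]_n.+1] rV_uncons.
Proof.
apply: measurable_fun_pair; first exact: measurable_coord.
apply: measurable_fun_rV => i.
rewrite [X in measurable_fun _ X](_ : _ =
    (fun x : 'rV[R]_(1 + n) => x ord0 (rshift 1 i) : R)).
  exact: measurable_coord.
by apply/funext => x; rewrite mxE.
Qed.

HB.instance Definition _ n :=
  @isMeasurableFun.Build _ _ _ _ (@rV_cons n) (@measurable_rV_cons n).

HB.instance Definition _ n :=
  @isMeasurableFun.Build _ _ _ _ (@rV_uncons n) (@measurable_rV_uncons n).

Section lebesgue_rV_succ.
Context {n : nat} (mu : {sigma_finite_measure set 'rV[R]_n -> \bar R}).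

Definition lebesgue_rV_succ : set 'rV[R]_n.+1 -> \bar R :=
  pushforward (lebesgue_measure \x mu)%E rV_cons.

Let lebesgue_rV_succ0 : lebesgue_rV_succ set0 = 0%E.
Proof. exact: measure0. Qed.

Let lebesgue_rV_succ_ge0 A : (0 <= lebesgue_rV_succ A)%E.
Proof. exact: measure_ge0. Qed.

Let lebesgue_rV_succ_sigma_additive : semi_sigma_additive lebesgue_rV_succ.
Proof. exact: measure_semi_sigma_additive. Qed.

HB.instance Definition _ := isMeasure.Build _ _ _ lebesgue_rV_succ
  lebesgue_rV_succ0 lebesgue_rV_succ_ge0 lebesgue_rV_succ_sigma_additive.

Let lebesgue_rV_succ_sigma_finite : sigma_finite setT lebesgue_rV_succ.
Proof.
have /sigma_finiteP[F [FT ndF Foo]] := sigma_finiteT (@lebesgue_measure R).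
have /sigma_finiteP[G [GT ndG Goo]] := sigma_finiteT mu.
exists (fun k => rV_uncons @^-1` (F k `*` G k)).
  rewrite -preimage_bigcup (_ : \bigcup_k _ = setT) ?preimage_setT//.
  apply/seteqP; split => // -[a y] _.
  have [k _ Fa] : (\bigcup_k F k) a by rewrite -FT.
  have [l _ Gy] : (\bigcup_k G k) y by rewrite -GT.
  exists (maxn k l) => //; split => /=.
    by move: a Fa; exact/subsetPset/ndF/leq_maxl.
  by move: y Gy; exact/subsetPset/ndG/leq_maxr.
move=> k; have [mF Fk] := Foo k; have [mG Gk] := Goo k; split.
  rewrite -[X in measurable X]setTI; apply: measurable_rV_uncons => //.
  exact: measurableX.
rewrite /lebesgue_rV_succ /pushforward -comp_preimage.
rewrite (_ : _ \o _ = id); last by apply/funext => p; exact: rV_consK.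
by rewrite preimage_id product_measure1E// lte_mul_pinfty// ge0_fin_numE.
Qed.

HB.instance Definition _ := Measure_isSigmaFinite.Build _ _ _ lebesgue_rV_succ
  lebesgue_rV_succ_sigma_finite.

End lebesgue_rV_succ.

(* n-dimensional Lebesgue measure, as an iterated product measure. *)
Fixpoint lebesgue_rV (n : nat) : {sigma_finite_measure set 'rV[R]_n -> \bar R} :=
  match n with
  | 0 => \d_(0 : 'rV[R]_0)
  | m.+1 => lebesgue_rV_succ (lebesgue_rV m)
  end.

End lebesgue_rV.

Section sphere.
Context {R : realType} {n : nat}.
Implicit Types x y : 'rV[R]_n.

Definition dotp x y : R := \sum_(i < n) x ord0 i * y ord0 i.

Definition enorm x : R := Num.sqrt (dotp x x).

Definition sphere : set 'rV[R]_n := [set x | enorm x = 1].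

Definition direction x : 'rV[R]_n := (enorm x)^-1 *: x.

Definition punctured_ball : set 'rV[R]_n := [set x | 0 < enorm x <= 1].

Lemma measurable_enorm : measurable_fun [set: 'rV[R]_n] enorm.
Proof.
rewrite [X in measurable_fun _ X](_ : _ =
  Num.sqrt \o (fun x : 'rV[R]_n => dotp x x))//.
apply: measurableT_comp.
  by apply: continuous_measurable_fun; exact: sqrt_continuous.
by apply: measurable_sum => i; apply: measurable_funM; exact: measurable_coord.
Qed.

Lemma measurable_direction : measurable_fun [set: 'rV[R]_n] direction.
Proof.
apply: measurable_fun_rV => i.
rewrite [X in measurable_fun _ X](_ : _ =
    (fun x : 'rV[R]_n => (enorm x) `^ (-1) * x ord0 i)); last first.
  by apply/funext => x; rewrite mxE powR_inv1// sqrtr_ge0.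
apply: measurable_funM; last exact: measurable_coord.
apply: (measurableT_comp (measurable_powR (-1))).
exact: measurable_enorm.
Qed.

HB.instance Definition _ :=
  isMeasurableFun.Build _ _ _ _ direction measurable_direction.

Lemma measurable_punctured_ball : measurable punctured_ball.
Proof.
rewrite (_ : punctured_ball = enorm @^-1` [set` `]0 : R, 1]]).
  by rewrite -[X in measurable X]setTI; exact: measurable_enorm.
by apply/seteqP; split => x /=; rewrite in_itv.
Qed.

(* Spherical Lebesgue measure, as the cone measure
     A |-> n * vol {x | 0 < |x| <= 1, x / |x| \in A};
   it is the (n-1)-dimensional surface measure of the unit sphere, seen as a
   measure on R^n concentrated on the sphere. *)
Definition cone_measure : set 'rV[R]_n -> \bar R :=
  pushforward (mrestr (@lebesgue_rV R n) measurable_punctured_ball) direction.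

Let cone_measure0 : cone_measure set0 = 0%E.
Proof. exact: measure0. Qed.

Let cone_measure_ge0 A : (0 <= cone_measure A)%E.
Proof. exact: measure_ge0. Qed.

Let cone_measure_sigma_additive : semi_sigma_additive cone_measure.
Proof. exact: measure_semi_sigma_additive. Qed.

HB.instance Definition _ := isMeasure.Build _ _ _ cone_measure
  cone_measure0 cone_measure_ge0 cone_measure_sigma_additive.

Definition sphere_measure : set 'rV[R]_n -> \bar R :=
  mscale (n%:R%:nng : {nonneg R}) cone_measure.

HB.instance Definition _ := Measure.on sphere_measure.

End sphere.
Arguments sphere R n : clear implicits.
Arguments sphere_measure R n : clear implicits.

Section dual_curvature.
Context {R : realType} {n : nat}.
Implicit Types (K : set 'rV[R]_n) (x u v : 'rV[R]_n) (eta : set 'rV[R]_n).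

Definition convex_body K :=
  [/\ compact K,
      convex_set (K : set (convex_lmodType 'rV[R]_n)) &
      K° !=set0].

Definition origin_symmetric K := K = [set - x | x in K].

Definition radial K x : R := sup [set l : R | 0 <= l /\ K (l *: x)].

Definition outer_unit_normal K x v :=
  sphere R n v /\ forall y, K y -> dotp y v <= dotp x v.

(* The set written alpha_K^*(eta) *)
Definition reverse_radial_gauss_image K eta : set 'rV[R]_n :=
  [set u | sphere R n u /\
     exists v, eta v /\ outer_unit_normal K (radial K u *: u) v].

(* For Borel eta, the domain of integration is measurable for the completion of
   sphere_measure but need not be Borel. Since the integrand is nonnegative,
   the integral is the supremum of the integrals of the Borel simple functions
   below it, and so agrees with the one for the completed measure. *)
Definition dual_curvature_measure (q : R) K eta : \bar R :=
  ((n%:R^-1)%:E *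
   \int[sphere_measure R n]_(u in reverse_radial_gauss_image K eta)
     (radial K u `^ q)%:E)%E.

End dual_curvature.

(* Main.v *)
(* Let K_c be the box |x_0| <= 2, |x_k| <= 1 (k > 0) truncated by the slab
   |x_0 + x_1| <= c, and let L_c be its image under the exchange of x_0 and x_1.
   The dual curvature measure of a polytope is carried by its facet normals, and
   up to a constant the mass at a normal is the integral of |x| ^ (q - n) over
   the part of the polytope in the cone spanned by the facet.  The normals
   +-(e_0 + e_1) and +-e_k, k > 1, have equal masses for K_c and L_c, so K_c and
   L_c have the same measure as soon as the masses F_0(c) and F_1(c) of K_c at
   e_0 and e_1 agree.
   For c = 1 the facet with normal e_0 degenerates, so F_0(1) = 0 <= F_1(1).  For
   c = 3 the truncation is void; the volume preserving map
   T x = (2 x_1, x_0 / 2, x_2, ...) sends the cone C over the facet with normal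
   e_0 to the cone over the facet with normal e_1, and |T x| <= |x| on C, whence
   F_1(3) <= F_0(3) because q > n.  Since F_0 and F_1 are continuous, they agree
   for some c in [1, 3]. *)

Require Import Defs.
From mathcomp Require Import all_boot all_order all_algebra perm.
From mathcomp Require Import all_classical all_reals all_analysis.
From mathcomp Require Import measurable_realfun ring lra.

Import Order.TTheory GRing.Theory Num.Theory.
Import numFieldNormedType.Exports.

Local Open Scope classical_set_scope.
Local Open Scope ring_scope.

Set Implicit Arguments.
Unset Strict Implicit.
Unset Printing Implicit Defensive.

(** * Integration over R^n *)

Section lebesgue_integral_rV.
Context {R : realType}.
Local Open Scope ereal_scope.
Local Notation leb := (@lebesgue_measure R).

(** The pushforward of Lebesgue measure under multiplication by [r], scaled by [|r|], gives []a, b]]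
    its length; uniqueness of Lebesgue measure identifies the two. For [r < 0] the preimage of []a,
    b]] is closed on the left instead. *)
Lemma ge0_integral_scale (r : R) (f : measurableTypeR R -> \bar R) : r != 0%R ->
  measurable_fun setT f -> (forall t, 0 <= f t) ->
  \int[leb]_t f t = `|r|%:E * \int[leb]_t f (r * t)%R.
Proof.
move=> r0 mf f0.
have mr : measurable_fun setT ( *%R r : measurableTypeR R -> measurableTypeR R).
  exact: mulrl_measurable.
have nr : (0 < `|r|)%R by rewrite normr_gt0.
pose k : {nonneg R} := NngNum (ltW nr).
pose nu : {measure set measurableTypeR R -> \bar R} :=
  measure_function_pushforward__canonical__measure_function_Measure leb mr.
transitivity (\int[mscale k nu]_t f t).
  apply: eq_measure_integral => A mA _.
  apply: lebesgue_measure_unique => //= _ [[a b]] _ <-.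
  rewrite -[RHS]/(`|r|%:E * leb ( *%R r @^-1` `]a, b]%classic)).
  rewrite lebesgue_measure_itv /= lte_fin.
  have [rp|rn] := ltP 0%R r.
    rewrite (_ : _ @^-1` _ = `](a / r)%R, (b / r)%R]%classic); last first.
      apply/seteqP; split => t /=; rewrite !in_itv /= ltr_pdivrMr// ler_pdivlMr//;
        by rewrite mulrC.
    rewrite lebesgue_measure_itv /= lte_fin ltr_pM2r ?invr_gt0//.
    case: ifPn => _; last by rewrite mule0.
    by rewrite -EFinB -EFinM gtr0_norm// -mulrBl mulrC divfK.
  have {}rn : (r < 0)%R by rewrite lt_neqAle r0.
  rewrite (_ : _ @^-1` _ = `[(b / r)%R, (a / r)%R[%classic); last first.
    apply/seteqP; split => t /=; rewrite !in_itv /= ltr_ndivlMr// ler_ndivrMr//;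
      by rewrite mulrC andbC.
  rewrite lebesgue_measure_itv /= lte_fin ltr_nM2r ?invr_lt0//.
  case: ifPn => _; last by rewrite mule0.
  by rewrite -EFinB -EFinM ltr0_norm// -mulrBl mulrC mulrN divfK// opprB.
rewrite ge0_integral_mscale//= ge0_integral_pushforward// => y _; exact: f0.
Qed.

Lemma ge0_integral_rVS m (f : 'rV[R]_m.+1 -> \bar R) :
  measurable_fun setT f -> (forall x, 0 <= f x) ->
  \int[lebesgue_rV m.+1]_x f x =
  \int[leb]_r \int[lebesgue_rV m]_y f (rV_cons (r, y)).
Proof.
move=> mf f0.
transitivity (\int[pushforward (leb \x lebesgue_rV m) rV_cons]_x f x) => //.
rewrite (ge0_integral_pushforward (@measurable_rV_cons _ _))//.
rewrite preimage_setT fubini_tonelli1//; last by move=> x; exact: f0.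
exact: (measurableT_comp mf (@measurable_rV_cons _ _)).
Qed.

Lemma measurable_rV_consl m (f : 'rV[R]_m.+1 -> \bar R) (r : R) :
  measurable_fun setT f ->
  measurable_fun setT (fun y : 'rV[R]_m => f (rV_cons (r, y))).
Proof.
move=> mf.
exact: (measurableT_comp (measurableT_comp mf (@measurable_rV_cons _ _)) (pair1_measurable r)).
Qed.

Lemma measurable_integral_rV_cons m (f : 'rV[R]_m.+1 -> \bar R) :
  measurable_fun setT f -> (forall x, 0 <= f x) ->
  measurable_fun [set: measurableTypeR R]
    (fun r => \int[lebesgue_rV m]_y f (rV_cons (r, y))).
Proof.
move=> mf f0; apply: (@measurable_fun_fubini_tonelli_F _ _ _ _ _ (lebesgue_rV m)
  (f \o rV_cons)) => [|x]; last exact: f0.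
exact: (measurableT_comp mf (@measurable_rV_cons _ _)).
Qed.

Lemma ge0_integral_rVS_swap m (f : 'rV[R]_m.+1 -> \bar R) :
  measurable_fun setT f -> (forall x, 0 <= f x) ->
  \int[lebesgue_rV m.+1]_x f x =
  \int[lebesgue_rV m]_y \int[leb]_r f (rV_cons (r, y)).
Proof.
move=> mf f0; rewrite ge0_integral_rVS//.
apply: (@fubini_tonelli _ _ _ _ _ leb (lebesgue_rV m) (f \o rV_cons)) => [|x];
  last exact: f0.
exact: (measurableT_comp mf (@measurable_rV_cons _ _)).
Qed.

Lemma rV_cons0 m (r : R) (y : 'rV[R]_m) : rV_cons (r, y) ord0 ord0 = r.
Proof. by have /(congr1 fst) := rV_consK (r, y). Qed.

Lemma rV_consS m (r : R) (y : 'rV[R]_m) i : rV_cons (r, y) ord0 (lift ord0 i) = y ord0 i.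
Proof.
by rewrite (_ : lift ord0 i = rshift 1 i); [exact: row_mxEr | exact: val_inj].
Qed.

Lemma scale_rV_cons m (r s : R) (y : 'rV[R]_m) :
  (r *: rV_cons (s, y) = rV_cons ((r * s)%R, r *: y))%R.
Proof.
apply/rowP => i; rewrite mxE.
by have [j ->|->] := unliftP ord0 i; rewrite ?rV_cons0// !rV_consS mxE.
Qed.

Lemma measurable_scale_rV m (r : R) :
  measurable_fun setT (fun x : 'rV[R]_m => r *: x)%R.
Proof.
apply: measurable_fun_rV => i; under eq_fun do rewrite mxE.
by apply: measurable_funM => //; exact: measurable_coord.
Qed.

(** Induction on the dimension, each coordinate contributing a factor [|r|]. *)
Lemma ge0_integral_rV_scale m (r : R) (f : 'rV[R]_m -> \bar R) : r != 0%R ->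
  measurable_fun setT f -> (forall x, 0 <= f x) ->
  \int[lebesgue_rV m]_x f x = (`|r| ^+ m)%:E * \int[lebesgue_rV m]_x f (r *: x)%R.
Proof.
move=> r0; elim: m f => [|m IH] f mf f0.
  by rewrite expr0 mul1e; apply: eq_integral => x _; rewrite [x]thinmx0 scaler0.
have mfr : measurable_fun setT (fun x : 'rV[R]_m.+1 => f (r *: x)%R).
  by apply: (measurableT_comp mf); exact: measurable_scale_rV.
rewrite (ge0_integral_rVS mf f0) (ge0_integral_rVS mfr (fun x => f0 _)).
rewrite (ge0_integral_scale r0 (measurable_integral_rV_cons mf f0)); last first.
  by move=> t; apply: integral_ge0.
rewrite exprS EFinM -muleA; congr (_ * _).
have mI := @measurable_integral_rV_cons _ (fun x : 'rV[R]_m.+1 => f (r *: x)%R) mfr (fun x => f0 _).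
rewrite -(ge0_integralZl_EFin leb measurableT _ mI) ?exprn_ge0//; last first.
  by move=> t _; apply: integral_ge0.
apply: eq_integral => t _; rewrite IH//; last exact: measurable_rV_consl.
by congr (_ * _); apply: eq_integral => y _; rewrite scale_rV_cons.
Qed.

Definition swap01 {m} (x : 'rV[R]_m.+2) : 'rV[R]_m.+2 :=
  col_perm (tperm ord0 (lift ord0 ord0)) x.

Lemma swap01_rV_cons m (r s : R) (z : 'rV[R]_m) :
  swap01 (rV_cons (r, rV_cons (s, z))) = rV_cons (s, rV_cons (r, z)).
Proof.
apply/rowP => i; rewrite mxE.
have [i' ->|->] := unliftP ord0 i; last by rewrite tpermL rV_consS !rV_cons0.
have [i'' ->|->] := unliftP ord0 i'; last by rewrite tpermR !rV_consS !rV_cons0.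
by rewrite tpermD ?rV_consS// -?(inj_eq (@lift_inj _ ord0)) ?(inj_eq lift_inj) neq_lift.
Qed.

Lemma measurable_swap01 m : measurable_fun setT (@swap01 m).
Proof.
by apply: measurable_fun_rV => i; under eq_fun do rewrite mxE; exact: measurable_coord.
Qed.

(** With the first two coordinates split off, exchanging them is exchanging the order of two
    integrations. *)
Lemma ge0_integral_swap01 m (f : 'rV[R]_m.+2 -> \bar R) :
  measurable_fun setT f -> (forall x, 0 <= f x) ->
  \int[lebesgue_rV m.+2]_x f x = \int[lebesgue_rV m.+2]_x f (swap01 x).
Proof.
move=> mf f0.
have mfs : measurable_fun setT (fun x => f (swap01 x)).
  by apply: (measurableT_comp mf); exact: measurable_swap01.
rewrite ge0_integral_rVS// [RHS]ge0_integral_rVS_swap//.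
have mI (r : R) : measurable_fun setT (fun y : 'rV_m.+1 => f (rV_cons (r, y))).
  exact: measurable_rV_consl.
rewrite [RHS](@ge0_integral_rVS _ (fun y => \int[leb]_r f (swap01 (rV_cons (r, y))))); last 2 first.
- apply: (@measurable_fun_fubini_tonelli_G _ _ _ _ _ leb ((f \o swap01) \o rV_cons)) => [|x].
    exact: (measurableT_comp mfs (@measurable_rV_cons _ _)).
  exact: f0.
- by move=> y; apply: integral_ge0 => r _; exact: f0.
apply: eq_integral => r _.
rewrite (ge0_integral_rVS_swap (mI r) (fun y => f0 _)).
by apply: eq_integral => z _; apply: eq_integral => s _; rewrite swap01_rV_cons.
Qed.

End lebesgue_integral_rV.

Lemma measurable_boolr d (T : measurableType d) (R : realType) (b : T -> bool) :
  measurable_fun setT b -> measurable_fun setT (fun x => (b x)%:R : R).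
Proof.
by move=> mb; apply: (@measurableT_comp _ _ _ _ _ _ (fun c : bool => c%:R : R)).
Qed.

(** For nonnegative arguments, 0 included, the inverse is the power of exponent -1, and powers are
    measurable. *)
Lemma measurable_funV_ge0 d (T : measurableType d) (R : realType) (f : T -> R) :
  (forall x, 0 <= f x) -> measurable_fun setT f ->
  measurable_fun setT (fun x => (f x)^-1).
Proof.
move=> f0 mf; rewrite [X in measurable_fun _ X](_ : _ = fun x => f x `^ (-1)).
  exact: (measurableT_comp (measurable_powR (-1))).
by apply/funext => x; rewrite powR_inv1.
Qed.

(** * Hyperplanes, the unit ball and integrals over cones *)

Section cone_integral.
Context {R : realType}.
Local Open Scope ereal_scope.
Local Notation leb := (@lebesgue_measure R).

Definition scale0 {m} (a : R) (x : 'rV[R]_m.+1) : 'rV[R]_m.+1 :=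
  \row_i ((if i == ord0 then a else 1%R) * x ord0 i)%R.

Lemma scale0_rV_cons m a (r : R) (y : 'rV[R]_m) :
  scale0 a (rV_cons (r, y)) = rV_cons ((a * r)%R, y).
Proof.
apply/rowP => i; rewrite mxE.
have [j ->|->] := unliftP ord0 i; last by rewrite eqxx !rV_cons0.
by rewrite eq_sym (negbTE (neq_lift _ _)) mul1r !rV_consS.
Qed.

Lemma measurable_scale0 m (a : R) : measurable_fun setT (@scale0 m a).
Proof.
apply: measurable_fun_rV => i; under eq_fun do rewrite mxE.
by apply: measurable_funM => //; exact: measurable_coord.
Qed.

Lemma ge0_integral_scale0 m (a : R) (f : 'rV[R]_m.+1 -> \bar R) : a != 0%R ->
  measurable_fun setT f -> (forall x, 0 <= f x) ->
  \int[lebesgue_rV m.+1]_x f x = `|a|%:E * \int[lebesgue_rV m.+1]_x f (scale0 a x).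
Proof.
move=> a0 mf f0.
have mfs := measurableT_comp mf (@measurable_scale0 m a).
rewrite (ge0_integral_rVS mf f0) (ge0_integral_rVS mfs (fun x => f0 _)).
rewrite (ge0_integral_scale a0 (measurable_integral_rV_cons mf f0)); last first.
  by move=> t; apply: integral_ge0.
congr (_ * _); apply: eq_integral => r _; apply: eq_integral => y _ /=.
by rewrite scale0_rV_cons.
Qed.

Lemma dotp_rV_cons m (r : R) (y : 'rV[R]_m) v :
  dotp (rV_cons (r, y)) v =
  (r * v ord0 ord0 + dotp y (\row_i v ord0 (lift ord0 i)))%R.
Proof.
rewrite /dotp big_ord_recl rV_cons0; congr (_ + _)%R.
by apply: eq_bigr => i _; rewrite rV_consS mxE.
Qed.

Lemma measurable_dotp m (v : 'rV[R]_m) : measurable_fun setT (fun x => dotp x v).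
Proof.
apply: measurable_sum => i; apply: measurable_funM => //.
exact: measurable_coord.
Qed.

Lemma measurable_hyperplane m (v : 'rV[R]_m) : measurable [set x | dotp x v = 0%R].
Proof.
rewrite (_ : [set _ | _] = (dotp ^~ v) @^-1` [set 0%R]); last by [].
by rewrite -[X in measurable X]setTI; exact: measurable_dotp.
Qed.

(** Induction on the dimension. If the first coordinate of [v] vanishes, the slices at fixed first
    coordinate are hyperplanes one dimension lower; otherwise every line parallel to the first axis
    meets the hyperplane in one point. *)
Lemma lebesgue_rV_hyperplane m (v : 'rV[R]_m) : v != 0%R ->
  lebesgue_rV m [set x | dotp x v = 0%R] = 0.
Proof.
elim: m v => [|m IH] v v0; first by rewrite [v]thinmx0 eqxx in v0.
have mA := measurable_hyperplane v.
rewrite -[X in lebesgue_rV _ X]setIT -integral_indic//.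
have mf : measurable_fun setT (fun x => (\1_[set x | dotp x v = 0%R] x)%:E : \bar R).
  by apply/measurable_EFinP; exact: measurable_indic.
have f0 (x : 'rV[R]_m.+1) : 0 <= (\1_[set x | dotp x v = 0%R] x)%:E :> \bar R by rewrite lee_fin.
set v' : 'rV[R]_m := (\row_i v ord0 (lift ord0 i))%R.
have [v00|v00] := eqVneq (v ord0 ord0) 0%R.
  have v'0 : v' != 0%R.
    apply: contra_neq v0 => v'0; apply/rowP => i; rewrite mxE.
    have [j ->|->//] := unliftP ord0 i.
    by move/rowP : v'0 => /(_ j); rewrite !mxE.
  rewrite (ge0_integral_rVS mf f0) integral0_eq// => r _.
  rewrite -[RHS](IH v' v'0) -[X in _ = lebesgue_rV _ X]setIT -integral_indic//; last first.
    exact: measurable_hyperplane.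
  apply: eq_integral => y _; congr EFin.
  by rewrite !indicE; congr ((_ : bool)%:R)%R; apply/idP/idP;
    rewrite !inE /= dotp_rV_cons v00 mulr0 add0r.
rewrite (ge0_integral_rVS_swap mf f0) integral0_eq// => y _.
have H : leb [set (- dotp y v' / v ord0 ord0)%R] = 0 by rewrite lebesgue_measure_set1.
rewrite -[RHS]H -[X in _ = leb X]setIT -integral_indic//.
apply: eq_integral => r _; congr EFin.
rewrite !indicE; congr ((_ : bool)%:R)%R; apply/idP/idP; rewrite !inE /= dotp_rV_cons -/v'.
  by move=> /eqP; rewrite addr_eq0 => /eqP <-; rewrite mulfK.
by move=> ->; rewrite divfK// addNr.
Qed.

(** Serves to bound the volume of the ball. Measurability travels with finiteness since the product
    formula asks for it one dimension lower. *)
Lemma lebesgue_rV_cube m :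
  lebesgue_rV m [set x : 'rV[R]_m | forall i, (`|x ord0 i| <= 1)%R] < +oo /\
  measurable [set x : 'rV[R]_m | forall i, (`|x ord0 i| <= 1)%R].
Proof.
elim: m => [|m [IH mC]].
  rewrite (_ : [set _ | _] = setT); first by split => //=; rewrite diracE ltry.
  by apply/seteqP; split => // x _ /= -[].
have E : rV_cons @^-1` [set x : 'rV[R]_m.+1 | forall i, (`|x ord0 i| <= 1)%R] =
   `[(-1)%R, 1%R]%classic `*` [set x : 'rV[R]_m | forall i, (`|x ord0 i| <= 1)%R].
  apply/seteqP; split => -[r y] /=.
    move=> H; split => [|i]; last by rewrite -(rV_consS r).
    by have := H ord0; rewrite rV_cons0 in_itv /= ler_norml.
  move=> [r1 y1] i; have [j ->|->] := unliftP ord0 i; first by rewrite rV_consS.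
  by rewrite rV_cons0 ler_norml; move: r1; rewrite in_itv.
split.
  rewrite -[X in X < _]/((leb \x lebesgue_rV m) _) E product_measure1E//.
  have H : leb `[(-1)%R, 1%R]%classic \is a fin_num.
    by rewrite lebesgue_measure_itv; case: ifP.
  by apply: lte_mul_pinfty => //; exact: H.
rewrite (_ : [set _ | _] = \bigcap_(i in setT)
    ((fun x : 'rV[R]_m.+1 => x ord0 i) @^-1` `[(-1)%R, 1%R]%classic)).
  apply: fin_bigcap_measurable => // i _.
  by rewrite -[X in measurable X]setTI; exact: measurable_coord.
apply/seteqP; split => [x H i _|x H i] /=; first by rewrite in_itv /= -ler_norml H.
by have := H i I; rewrite /= in_itv /= -ler_norml.
Qed.

Lemma ler_coord_enorm m (x : 'rV[R]_m) i : (`|x ord0 i| <= enorm x)%R.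
Proof.
rewrite -sqrtr_sqr ler_wsqrtr// /dotp (bigD1 i)//= -expr2 lerDl.
by apply: sumr_ge0 => j _; rewrite -expr2 sqr_ge0.
Qed.

Lemma lebesgue_rV_punctured_ball m : lebesgue_rV m (@punctured_ball R m) < +oo.
Proof.
have [+ mC] := lebesgue_rV_cube m; apply: le_lt_trans; apply: le_measure => //.
- by rewrite inE; exact: measurable_punctured_ball.
- by rewrite inE.
by move=> x /= /andP[_ x1] i; exact: le_trans (ler_coord_enorm x i) x1.
Qed.

(* Gnomonic coordinates: each ray in the half-space [0 < x_0] meets the
   hyperplane [x_0 = 1] at one point [(1, s)]. *)
Lemma integral_halfspace_cone m (u f : 'rV[R]_m.+1 -> R) :
  measurable_fun setT u -> measurable_fun setT f -> (forall x, 0 <= f x)%R ->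
  (forall s, 0 < u (rV_cons (1, s)))%R ->
  (forall r x, 0 < r -> u (r *: x) = u x)%R ->
  (forall r x, 0 < r -> f (r *: x) = f x)%R ->
  \int[lebesgue_rV m.+1]_x
     (((0 < x ord0 ord0) && (x ord0 ord0 * u x <= 1))%:R * f x)%:E =
  (\int[leb]_r (((0 < r) && (r <= 1))%:R * `|r| ^+ m)%:E) *
  \int[lebesgue_rV m]_s (f (rV_cons (1, s)) / u (rV_cons (1, s)) ^+ m.+1)%:E.
Proof.
move=> mu mf f0 u0 uh fh.
have m1 (g : 'rV[R]_m.+1 -> R) : measurable_fun setT g ->
    measurable_fun setT (fun s : 'rV[R]_m => g (rV_cons (1%R, s))).
  move=> mg; exact: (measurableT_comp (measurableT_comp mg (@measurable_rV_cons _ _))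
    (pair1_measurable (1%R : measurableTypeR R))).
pose G (p : measurableTypeR R * 'rV[R]_m) : \bar R :=
  (((0 < p.1) && (p.1 * u (rV_cons (1, p.2)) <= 1))%:R * `|p.1| ^+ m * f (rV_cons (1, p.2)))%:E.
have mG : measurable_fun setT G.
  have m2 (g : 'rV[R]_m.+1 -> R) : measurable_fun setT g ->
    measurable_fun [set: measurableTypeR R * 'rV[R]_m] (fun p => g (rV_cons (1%R, p.2))).
    by move=> mg; exact: (measurableT_comp (m1 _ mg) measurable_snd).
  have mfst : measurable_fun [set: measurableTypeR R * 'rV[R]_m] (fun p => p.1 : R)
    by exact: measurable_fst.
  apply/measurable_EFinP; apply: measurable_funM; last exact: m2.
  apply: measurable_funM; last first.
    by apply: measurable_funX; apply: measurableT_comp.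
  apply: measurable_boolr; apply: measurable_and.
    exact: measurable_fun_ltr.
  by apply: measurable_fun_ler => //; apply: measurable_funM => //; exact: m2.
have G0 p : 0 <= G p by rewrite lee_fin !mulr_ge0// exprn_ge0.
have m0 : measurable_fun setT (fun x : 'rV[R]_m.+1 => x ord0 ord0 : R) by exact: measurable_coord.
set H := fun x : 'rV[R]_m.+1 => (((0 < x ord0 ord0) && (x ord0 ord0 * u x <= 1))%:R * f x)%:E.
have mH : measurable_fun setT H.
  apply/measurable_EFinP; apply: measurable_funM => //.
  apply: measurable_boolr; apply: measurable_and; first exact: measurable_fun_ltr.
  by apply: measurable_fun_ler => //; exact: measurable_funM.
have H0 x : 0 <= H x by rewrite lee_fin mulr_ge0.
rewrite (ge0_integral_rVS mH H0).
have cons1 (r : R) (s : 'rV[R]_m) : rV_cons (r, r *: s)%R = (r *: rV_cons (1, s))%R.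
  by rewrite scale_rV_cons mulr1.
transitivity (\int[leb]_r \int[lebesgue_rV m]_s G (r, s)).
  apply: eq_integral => r _.
  have [r0|r0] := ltP 0%R r; last first.
    by rewrite !integral0_eq// => s _; rewrite /G /H/= ?rV_cons0 ltNge r0/= ?mul0r.
  have mHr := measurable_rV_consl r mH.
  (* Substituting [r *: s] in the slice at height [r] moves the point onto the ray through [(1, s)]
     and costs a factor [r ^ m]. *)
  rewrite (ge0_integral_rV_scale (lt0r_neq0 r0) mHr (fun y => H0 _)).
  rewrite -(@ge0_integralZl_EFin _ _ _ _ _ measurableT _ _
    (measurableT_comp mHr (@measurable_scale_rV _ _ r)))
    ?exprn_ge0//; last by move=> y _; exact: H0.
  apply: eq_integral => s _; rewrite -EFinM /G/= cons1 uh// fh//.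
  by rewrite -cons1 rV_cons0 mulrA; congr (_ * _)%:E; rewrite mulrC.
transitivity (\int[lebesgue_rV m]_s \int[leb]_r G (r, s)).
  exact: (@fubini_tonelli _ _ _ _ _ leb (lebesgue_rV m) G mG G0).
set K := (X in X * _).
have mf1 := m1 _ mf; have mu1 := m1 _ mu.
have mg : measurable_fun setT (fun s => (f (rV_cons (1, s)) / u (rV_cons (1, s)) ^+ m.+1)%:E).
  apply/measurable_EFinP; apply: measurable_funM => //.
  apply: measurable_funV_ge0 => [s|]; first by rewrite exprn_ge0// ltW.
  exact: measurable_funX.
have K0 : 0 <= K by apply: integral_ge0 => r _; rewrite lee_fin mulr_ge0// exprn_ge0.
rewrite -ge0_integralZl//; last by move=> s _; rewrite lee_fin divr_ge0// exprn_ge0// ltW.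
apply: eq_integral => s _.
have us := u0 s.
set us1 := u _ in us *.
have ui : (us1^-1 != 0)%R by rewrite invr_neq0// lt0r_neq0.
have mGs : measurable_fun [set: measurableTypeR R] (fun r => G (r, s)).
  exact: (measurableT_comp mG (pair2_measurable s)).
(* Dividing [r] by [us1] makes the range of [r] independent of [s]; the Jacobian and [r ^ m]
   together release the power [m.+1] of [us1^-1]. *)
rewrite (ge0_integral_scale ui mGs) => [|t]; last exact: G0.
transitivity (`|us1^-1|%:E * \int[leb]_r ((f (rV_cons (1%R, s)) / us1 ^+ m)%:E *
    (((0 < r) && (r <= 1))%:R * `|r| ^+ m)%:E)).
  congr (_ * _); apply: eq_integral => r _; rewrite /G/= -/us1 -EFinM; congr EFin.
  rewrite pmulr_rgt0 ?invr_gt0// (_ : us1^-1 * r * us1 = r)%R; last first.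
    by rewrite mulrAC mulVf ?lt0r_neq0// mul1r.
  rewrite normrM exprMn gtr0_norm ?invr_gt0// exprVn; ring.
rewrite ge0_integralZl_EFin; last 4 first.
- exact: measurableT.
- by move=> r _; rewrite lee_fin mulr_ge0// exprn_ge0.
- apply/measurable_EFinP; apply: measurable_funM.
    apply: measurable_boolr; apply: measurable_and; first exact: measurable_fun_ltr.
    exact: measurable_fun_ler.
  by apply: measurable_funX; exact: normr_measurable.
- by apply: divr_ge0; [exact: f0 | exact/exprn_ge0/ltW].
rewrite muleA muleC -EFinM; congr (_ * _%:E).
by rewrite gtr0_norm ?invr_gt0// exprS invfM; ring.
Qed.

End cone_integral.

(** * Polytopes and their facet weights *)

Section dotp_theory.
Context {R : realType} {n : nat}.
Implicit Types x y v : 'rV[R]_n.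

Lemma dotpC x y : dotp x y = dotp y x.
Proof. by apply: eq_bigr => i _; rewrite mulrC. Qed.

Lemma dotpDl x y v : dotp (x + y) v = dotp x v + dotp y v.
Proof. by rewrite -big_split; apply: eq_bigr => i _; rewrite mxE mulrDl. Qed.

Lemma dotpZl a x v : dotp (a *: x) v = a * dotp x v.
Proof. by rewrite mulr_sumr; apply: eq_bigr => i _; rewrite mxE mulrA. Qed.

Lemma dotpNl x v : dotp (- x) v = - dotp x v.
Proof. by rewrite -scaleN1r dotpZl mulN1r. Qed.

Lemma dotpBl x y v : dotp (x - y) v = dotp x v - dotp y v.
Proof. by rewrite dotpDl dotpNl. Qed.

Lemma dotp0l v : dotp 0 v = 0.
Proof. by rewrite -(scale0r 0) dotpZl mul0r. Qed.

Lemma dotpZr a x v : dotp x (a *: v) = a * dotp x v.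
Proof. by rewrite dotpC dotpZl dotpC. Qed.

Lemma dotpBr x v y : dotp x (v - y) = dotp x v - dotp x y.
Proof. by rewrite dotpC dotpBl !(dotpC x). Qed.

Lemma dotpxx_ge0 x : 0 <= dotp x x.
Proof. by apply: sumr_ge0 => i _; rewrite -expr2 sqr_ge0. Qed.

Lemma dotpxx_eq0 x : (dotp x x == 0) = (x == 0).
Proof.
apply/idP/eqP => [|->]; last by rewrite dotp0l.
rewrite psumr_eq0 => [/allP H|i _]; last by rewrite -expr2 sqr_ge0.
apply/rowP => i; rewrite mxE; apply/eqP; rewrite -sqrf_eq0 expr2.
by apply: H; rewrite mem_index_enum.
Qed.

Lemma enorm_ge0 x : 0 <= enorm x.
Proof. exact: sqrtr_ge0. Qed.

Lemma enorm_eq0 x : (enorm x == 0) = (x == 0).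
Proof. by rewrite sqrtr_eq0 le_eqVlt ltNge dotpxx_ge0 orbF dotpxx_eq0. Qed.

Lemma enorm_gt0 x : (0 < enorm x) = (x != 0).
Proof. by rewrite lt_neqAle enorm_ge0 andbT eq_sym enorm_eq0. Qed.

Lemma enormZ a x : enorm (a *: x) = `|a| * enorm x.
Proof.
by rewrite /enorm dotpZl dotpZr mulrA -expr2 sqrtrM ?sqr_ge0// sqrtr_sqr.
Qed.

Lemma enorm_direction x : x != 0 -> enorm (direction x) = 1.
Proof.
rewrite -enorm_gt0 => x0.
by rewrite enormZ gtr0_norm ?invr_gt0// mulVf// gt_eqF.
Qed.

Lemma continuous_dotp v : continuous (fun x : 'rV[R]_n => dotp x v : R).
Proof.
have H i : continuous (fun x : 'rV[R]_n => x ord0 i * v ord0 i : R).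
  move=> x.
  have Hx : {for x, continuous (fun x : 'rV[R]_n => x ord0 i : R)} by exact: coord_continuous.
  exact: (cvgM Hx (cvg_cst (v ord0 i))).
rewrite /dotp; elim: (index_enum _) => [|i s IH].
  by under eq_fun do rewrite big_nil; exact: cst_continuous.
under eq_fun do rewrite big_cons.
move=> x; exact: (cvgD (H i x) (IH x)).
Qed.

End dotp_theory.

(** * Normal vectors and the gauge of a polytope *)

Section polytope.
Context {R : realType} {n : nat} {J : finType}.
Variable w : J -> 'rV[R]_n.
Implicit Types (x y v : 'rV[R]_n) (j k : J).

Definition polytope : set 'rV[R]_n := [set x | forall j, dotp x (w j) <= 1].

(** For nonzero [x], under [wpos] below, these are the constraints that are tight where the ray
    through [x] leaves the polytope. Comparing the forms with each other makes the notion invariant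
    under positive scaling. *)
Definition active x j := [forall k, dotp x (w k) <= dotp x (w j)].

Definition gauge x : R := \big[Num.max/0]_j dotp x (w j).

Lemma activeP x j : reflect (forall k, dotp x (w k) <= dotp x (w j)) (active x j).
Proof. exact: forallP. Qed.

Lemma ler_gauge x j : dotp x (w j) <= gauge x.
Proof. exact: (le_bigmax _ (fun j => dotp x (w j))). Qed.

Lemma gaugeZ a x : 0 <= a -> gauge (a *: x) = a * gauge x.
Proof.
move=> a0; rewrite /gauge (big_morph _ (fun y z : R => maxr_pMr y z a0) (mulr0 a)).
by apply: eq_bigr => j _; rewrite dotpZl.
Qed.

Lemma measurable_gauge : measurable_fun setT gauge.
Proof.
rewrite /gauge; elim: (index_enum J) => [|j s IH].
  by under eq_fun do rewrite big_nil; exact: measurable_cst.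
under eq_fun do rewrite big_cons.
by apply: measurable_maxr => //; exact: measurable_dotp.
Qed.

(** Slack constraints survive a small enough step, and the tight ones do not increase along [y];
    finitely many constraints admit a common step. *)
Lemma polytope_near x y : (forall k, dotp x (w k) <= 1) ->
  (forall k, dotp x (w k) = 1 -> dotp y (w k) <= 0) ->
  exists2 e : R, 0 < e & polytope (x + e *: y).
Proof.
move=> Kx xy.
have : \forall e \near (0:R)^'+, 0 < e /\ polytope (x + e *: y).
  apply: filterI; first exact: nbhs_right_gt.
  suff H k : \forall e \near (0:R)^'+, dotp (x + e *: y) (w k) <= 1.
    exact: (filter_forall _ H).
  under eq_near do rewrite dotpDl dotpZl.
  have [y0|y0] := leP (dotp y (w k)) 0.
    near=> e.
    have e0 : 0 < e by near: e; exact: nbhs_right_gt.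
    by rewrite (le_trans _ (Kx k))// gerDl pmulr_rle0.
  have x1 : dotp x (w k) < 1.
    rewrite lt_neqAle Kx andbT; apply: contraTN y0 => /eqP /xy.
    by rewrite leNgt.
  near=> e; rewrite -lerBrDl -ler_pdivlMr// ltW//; near: e.
  by apply: nbhs_right_lt; rewrite divr_gt0// subr_gt0.
by move=> /filter_ex[e [e0 Ke]]; exists e.
Unshelve. all: by end_near. Qed.

Lemma outer_unit_normal_le0 x v y : outer_unit_normal polytope x v ->
  (forall k, dotp x (w k) <= 1) ->
  (forall k, dotp x (w k) = 1 -> dotp y (w k) <= 0) -> dotp y v <= 0.
Proof.
move=> [_ vmax] Kx xy; have [e e0 /vmax] := polytope_near Kx xy.
by rewrite dotpDl dotpZl gerDl pmulr_rle0.
Qed.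

(** Since [x] and [y] have the same tight constraints, [x - y] is an admissible direction at [x], so
    the form [v] is no larger at [x] than at [y]. The normals thus depend only on the face, which is
    what makes Gauss images measurable. *)
Lemma outer_unit_normal_face x y v : polytope x -> polytope y ->
  (forall k, (dotp x (w k) == 1) = (dotp y (w k) == 1)) ->
  outer_unit_normal polytope x v -> outer_unit_normal polytope y v.
Proof.
move=> Kx Ky xy nv; have := nv => -[v1 vmax]; split=> // z Kz.
have xyv : dotp (x - y) v <= 0.
  apply: (outer_unit_normal_le0 nv) => // k xk.
  by move: (xy k); rewrite xk eqxx => /esym/eqP yk; rewrite dotpBl xk yk subrr.
have := vmax _ Kz; move: xyv; rewrite dotpBl; lra.
Qed.

(** No ray stays inside the polytope, so [gauge] is positive away from the origin. *)
Hypothesis wpos : forall x, x != 0 -> exists j, 0 < dotp x (w j).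

Lemma exists_active x : x != 0 -> exists j, active x j.
Proof.
move=> /wpos[j0 _]; have [j _ jmax] := @arg_maxP _ _ _ j0 xpredT (fun j => dotp x (w j)) isT.
by exists j; apply/activeP => k; exact: jmax.
Qed.

Lemma gauge_gt0 x : x != 0 -> 0 < gauge x.
Proof. by move=> /wpos[j] /lt_le_trans; apply; exact: ler_gauge. Qed.

Lemma active_gauge x j : x != 0 -> active x j = (dotp x (w j) == gauge x).
Proof.
move=> x0; apply/activeP/eqP => [H|-> k]; last exact: ler_gauge.
apply/le_anti; rewrite ler_gauge/=; apply: bigmax_le => //.
by have [k /ltW xk] := wpos x0; exact: le_trans xk (H k).
Qed.

Lemma radial_polytope x : x != 0 -> radial polytope x = (gauge x)^-1.
Proof.
move=> x0; have g0 := gauge_gt0 x0.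
rewrite /radial (_ : [set _ | _] = `[0, (gauge x)^-1]%classic).
  by rewrite sup_itv// bnd_simp invr_ge0 ltW.
have [j] := exists_active x0; rewrite active_gauge// => /eqP E.
apply/seteqP; split => l /=; rewrite in_itv /=.
  move=> [l0 /(_ j)]; rewrite l0 dotpZl => Kl.
  by rewrite -[_^-1]mul1r ler_pdivlMr// -E.
move=> /andP[l0 lg]; split => // k; rewrite dotpZl.
rewrite (@le_trans _ _ (l * gauge x))// ?ler_wpM2l ?ler_gauge//.
by rewrite -ler_pdivlMr// mul1r.
Qed.

Definition boundary_point x := radial polytope x *: x.

Lemma polytope_boundary_point x : x != 0 -> polytope (boundary_point x).
Proof.
move=> x0 k; rewrite dotpZl radial_polytope// mulrC ler_pdivrMr ?gauge_gt0//.
by rewrite mul1r ler_gauge.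
Qed.

Lemma boundary_point_active x k : x != 0 ->
  (dotp (boundary_point x) (w k) == 1) = active x k.
Proof.
move=> x0; rewrite active_gauge// dotpZl radial_polytope//.
by rewrite -(inj_eq (mulfI (lt0r_neq0 (gauge_gt0 x0)))) mulVKf ?mulr1// lt0r_neq0 ?gauge_gt0.
Qed.

Lemma outer_unit_normal_active x y v : x != 0 -> y != 0 -> active x =1 active y ->
  outer_unit_normal polytope (boundary_point x) v ->
  outer_unit_normal polytope (boundary_point y) v.
Proof.
move=> x0 y0 xy; apply: outer_unit_normal_face; try exact: polytope_boundary_point.
by move=> k; rewrite !boundary_point_active.
Qed.

Lemma active_neq0 x j : x != 0 -> active x j -> w j != 0.
Proof.
move=> x0; rewrite active_gauge// => /eqP xj; apply/eqP => wj.
by have := gauge_gt0 x0; rewrite -xj wj dotpC dotp0l ltxx.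
Qed.

(** With [w j] the only tight form, every [y] with [dotp y (w j) <= 0] is admissible, hence
    [dotp y v <= 0]. Testing the part of [v] orthogonal to [w j], then [- w j], shows that [v] is a
    nonnegative multiple of [w j]. *)
Lemma outer_unit_normal_facet x j v : x != 0 -> active x j ->
  (forall k, active x k -> k = j) ->
  outer_unit_normal polytope (boundary_point x) v <-> v = direction (w j).
Proof.
move=> x0 xj juniq.
have pj : dotp (boundary_point x) (w j) = 1 by apply/eqP; rewrite boundary_point_active.
have wj0 := active_neq0 x0 xj.
have nj : 0 < enorm (w j) by rewrite enorm_gt0.
split => [nv|->]; last first.
  split => [|y Ky]; first exact: enorm_direction.
  by rewrite !dotpZr pj ler_pM2l ?invr_gt0.
have vle0 y : dotp y (w j) <= 0 -> dotp y v <= 0.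
  move=> yj; apply: (outer_unit_normal_le0 nv) => [|k].
    exact: polytope_boundary_point.
  by move=> /eqP; rewrite boundary_point_active// => /juniq ->.
have wwj : dotp (w j) (w j) != 0 by rewrite dotpxx_eq0.
pose t := dotp v (w j) / dotp (w j) (w j).
pose z := v - t *: w j.
have zj : dotp z (w j) = 0 by rewrite dotpBl dotpZl divfK// subrr.
have z0 : z = 0.
  apply/eqP; rewrite -dotpxx_eq0 eq_le dotpxx_ge0 andbT.
  by rewrite dotpBr dotpZr zj mulr0 subr0 vle0// zj.
have vE : v = t *: w j by apply/eqP; rewrite -subr_eq0 -/z z0.
have t0 : 0 <= t.
  have : dotp (- w j) v <= 0 by apply: vle0; rewrite dotpNl oppr_le0 dotpxx_ge0.
  rewrite dotpNl oppr_le0 vE dotpZr pmulr_lge0//.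
  by rewrite lt_neqAle eq_sym wwj dotpxx_ge0.
have [v1 _] := nv; move: v1; rewrite /sphere /= vE enormZ ger0_norm// => v1.
by congr (_ *: _); apply: (mulIf (lt0r_neq0 nj)); rewrite v1 mulVf ?lt0r_neq0.
Qed.

Lemma activeZ a x j : 0 < a -> active (a *: x) j = active x j.
Proof.
move=> a0; apply/activeP/activeP => H k; have := H k; rewrite !dotpZl ler_pM2l//.
Qed.

Lemma measurable_active j : measurable_fun setT (active ^~ j).
Proof.
rewrite (_ : active ^~ j = fun x => \big[andb/true]_(k : J) (dotp x (w k) <= dotp x (w j))).
  elim: (index_enum J) => [|k s IH].
    by under eq_fun do rewrite big_nil; exact: measurable_cst.
  under eq_fun do rewrite big_cons.
  apply: measurable_and => //.
  by apply: measurable_fun_ler; exact: measurable_dotp.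
by apply/funext => x; rewrite big_andE.
Qed.

End polytope.

Lemma ge0_integral_mrestr d (T : measurableType d) (R : realType)
    (mu : {measure set T -> \bar R}) (A B : set T) (mB : measurable B)
    (f : T -> \bar R) :
  measurable A -> measurable_fun A f -> (forall x, A x -> 0 <= f x)%E ->
  (\int[mrestr mu mB]_(x in A) f x = \int[mu]_(x in A `&` B) f x)%E.
Proof.
move=> mA mf f0.
have AE : A `&` B `|` A `\` B = A by rewrite setUIDK.
rewrite -[X in integral _ X _ = _]AE ge0_integral_setU//; last 5 first.
- exact: measurableI.
- exact: measurableD.
- by rewrite AE.
- by move=> x; rewrite AE; exact: f0.
- by apply/disj_setPS => x [[_ Bx] [_ nBx]].
rewrite [X in (_ + X)%E](_ : _ = 0%E) ?adde0.
  by apply: eq_measure_integral => S mS SAB; rewrite /= /mrestr setIidl// => x /SAB[].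
rewrite -[RHS](integral_measure_zero (A `\` B) f).
apply: eq_measure_integral => S mS SAB; rewrite /= /mrestr /mzero.
by rewrite (_ : S `&` B = set0) ?measure0// -subset0 => x [/SAB[]].
Qed.

(** * The dual curvature measure of a polytope as a sum over facets *)

Section facet_weight.
Context {R : realType} {n : nat} {J : finType}.
Variables (q : R) (w : J -> 'rV[R]_n.+1).

(** On the cone over the facet the base of the power is the radial function at [direction x]: this
    is the integrand of the dual curvature measure, extended as a constant along rays and cut off at
    the unit ball as in [cone_measure]. *)
Definition facet_density j (x : 'rV[R]_n.+1) : R :=
  ((0 < enorm x <= 1) && active w x j)%:R * (enorm x / dotp x (w j)) `^ q.

(* In polar coordinates, [q / n.+1] times the integral of [|x| ^ (q - n.+1)] over
   the part of [polytope w] in the cone spanned by the facet with normal [w j]. *)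
Definition facet_weight j : \bar R :=
  (\int[lebesgue_rV n.+1]_x (facet_density j x)%:E)%E.

Lemma facet_density_ge0 j x : 0 <= facet_density j x.
Proof. by rewrite mulr_ge0// powR_ge0. Qed.

Hypothesis wpos : forall x, x != 0 -> exists j, 0 < dotp x (w j).

(** On the support both denominators agree; [gauge] is nonnegative everywhere, as measurability of
    the inverse requires. *)
Lemma facet_density_gauge j x :
  facet_density j x = ((0 < enorm x <= 1) && active w x j)%:R * (enorm x / gauge w x) `^ q.
Proof.
rewrite /facet_density; have [/andP[/andP[+ _]]|_] := boolP (_ && active w x j);
  last by rewrite !mul0r.
by rewrite enorm_gt0 => x0; rewrite active_gauge// => /eqP ->.
Qed.

Lemma measurable_facet_density j : measurable_fun setT (facet_density j).
Proof.
rewrite (_ : facet_density j = fun x => ((0 < enorm x <= 1) && active w x j)%:R *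
    (enorm x / gauge w x) `^ q); last by apply/funext => x; exact: facet_density_gauge.
apply: measurable_funM.
  apply: measurable_boolr; apply: measurable_and; last exact: measurable_active.
  apply: measurable_and; first by apply: measurable_fun_ltr => //; exact: measurable_enorm.
  by apply: measurable_fun_ler => //; exact: measurable_enorm.
apply: (measurableT_comp (measurable_powR q)).
apply: measurable_funM; first exact: measurable_enorm.
apply: measurable_funV_ge0; last exact: measurable_gauge.
by move=> x; rewrite /gauge; exact: bigmax_ge_id.
Qed.

Lemma measurable_sphere : measurable (sphere R n.+1).
Proof.
rewrite (_ : sphere R n.+1 = enorm @^-1` [set 1]); last by [].
by rewrite -[X in measurable X]setTI; exact: measurable_enorm.
Qed.

(** Whether a direction belongs to the image depends only on its set of active constraints, by
    [outer_unit_normal_active]. The image is therefore a finite union of measurable pieces of the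
    sphere, whatever [eta] is. *)
Lemma measurable_gauss_image eta :
  measurable (reverse_radial_gauss_image (polytope w) eta).
Proof.
set D := reverse_radial_gauss_image _ _.
pose face (x : 'rV[R]_n.+1) : {set J} := [set j | active w x j]%SET.
have sphere0 x : sphere R n.+1 x -> x != 0.
  by rewrite -enorm_gt0 /sphere /= => ->.
have DE : D = sphere R n.+1 `&` \bigcup_(S in face @` D) (face @^-1` [set S]).
  apply/seteqP; split => [u Du|u [u1 [_ [x [x1 [v [etav nv]]] <-] /= uE]]].
    by split; [case: Du | exists (face u) => //; exists u].
  split => //; exists v; split => //.
  apply: (outer_unit_normal_active wpos (sphere0 _ x1) (sphere0 _ u1)) nv => j.
  by have /setP/(_ j) := uE; rewrite !inE.
rewrite DE; apply: measurableI; first exact: measurable_sphere.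
rewrite bigcup_mkcond; apply: countable_bigcupT_measurable => // S.
case: ifPn => // _.
rewrite (_ : _ @^-1` _ = \bigcap_(j in [set: J]) (active w ^~ j @^-1` [set (j \in S)])).
  apply: fin_bigcap_measurable => // j _.
  by rewrite -[X in measurable X]setTI; exact: measurable_active.
apply/seteqP; split => [x /= <- j _|x xS] /=; first by rewrite inE.
by apply/setP => j; rewrite inE; exact: xS.
Qed.

Hypothesis winj : injective w.

(** Two distinct active constraints put [x] on the hyperplane orthogonal to [w j - w k], which is
    null; there are finitely many pairs. *)
Lemma ae_active_unique : {ae lebesgue_rV n.+1, forall x, forall j k,
  active w x j -> active w x k -> j = k}.
Proof.
have H (p : J * J) : {ae lebesgue_rV n.+1, forall x, 
    active w x p.1 -> active w x p.2 -> p.1 = p.2}.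
  have [->|p12] := eqVneq p.1 p.2; first exact: aeW.
  exists [set x | dotp x (w p.1 - w p.2) = 0]; split.
  - exact: measurable_hyperplane.
  - by apply: lebesgue_rV_hyperplane; rewrite subr_eq0 (inj_eq winj).
  - move=> x /= /not_implyP[/activeP x1] /not_implyP[/activeP x2 _].
    by apply/eqP; rewrite dotpBr subr_eq0 eq_le x1 x2.
have F := ae_filter_ringOfSetsType (@lebesgue_rV R n.+1).
by apply: (@filterS _ _ F _ _ _ (@filter_forall _ _ _ _ F H)) => x Hx j k; exact: (Hx (j, k)).
Qed.

(** The factor in [sphere_measure] cancels the normalisation, leaving an integral over the ball of a
    function constant along rays. Almost every point lies over a single facet, whose only normal is
    [direction (w j)]. *)
Lemma dual_curvature_polytope eta :
  dual_curvature_measure q (polytope w) eta =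
  (\sum_(j : J) ((direction (w j) \in eta)%:R)%:E * facet_weight j)%E.
Proof.
rewrite /dual_curvature_measure.
set D := reverse_radial_gauss_image _ _.
have mD : measurable D by exact: measurable_gauss_image.
pose h (u : 'rV[R]_n.+1) : \bar R := (((gauge w u)^-1) `^ q)%:E.
have g0 x : 0 <= gauge w x by rewrite /gauge; exact: bigmax_ge_id.
have mh : measurable_fun setT h.
  apply/measurable_EFinP; apply: (measurableT_comp (measurable_powR q)).
  by apply: measurable_funV_ge0 => //; exact: measurable_gauge.
have h0 u : (0 <= h u)%E by rewrite lee_fin powR_ge0.
have sphere0 x : sphere R n.+1 x -> x != 0.
  by rewrite -enorm_gt0 /sphere /= => ->.
transitivity ((n.+1%:R^-1)%:E * \int[sphere_measure R n.+1]_(u in D) h u)%E.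
  congr (_ * _)%E; apply: eq_integral => u /set_mem[u1 _].
  by rewrite /h radial_polytope// sphere0.
rewrite ge0_integral_mscale//; last exact: measurable_funS mh.
rewrite muleA -EFinM mulVf ?pnatr_eq0// mul1e.
transitivity (\int[pushforward (mrestr (lebesgue_rV n.+1)
  (@measurable_punctured_ball R n.+1)) direction]_(u in D) h u)%E => //.
rewrite (ge0_integral_pushforward (@measurable_direction _ _))//; last exact: measurable_funS mh.
have mpD : measurable (direction @^-1` D : set 'rV[R]_n.+1).
  by rewrite -[X in measurable X]setTI; exact: measurable_direction.
have mhd : measurable_fun setT (h \o @direction R n.+1).
  exact: (measurableT_comp mh (@measurable_direction _ _)).
rewrite ge0_integral_mrestr//; last 2 first.
- exact: measurable_funS mhd.
- by move=> x _; exact: h0.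
rewrite integral_mkcond.
transitivity (\int[lebesgue_rV n.+1]_x \sum_(j : J)
    ((direction (w j) \in eta)%:R)%:E * (facet_density j x)%:E)%E; last first.
  have md j : measurable_fun setT (fun x => (facet_density j x)%:E).
    by apply/measurable_EFinP; exact: measurable_facet_density.
  rewrite ge0_integral_sum//; last 2 first.
  - by move=> j; exact: measurable_funeM.
  - by move=> j x _; rewrite mule_ge0// lee_fin ?facet_density_ge0.
  apply: eq_bigr => j _; rewrite ge0_integralZl_EFin// => x _.
  by rewrite lee_fin facet_density_ge0.
apply: ge0_ae_eq_integral => //.
- have mE := measurableI _ _ mpD (@measurable_punctured_ball R n.+1).
  by apply/(measurable_restrictT _ mE); exact: measurable_funS mhd.
- apply: emeasurable_sum => j; apply: measurable_funeM; apply/measurable_EFinP.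
  exact: measurable_facet_density.
- by move=> x _; rewrite patchE; case: ifP => // _; exact: h0.
- move=> x _; apply: sume_ge0 => j _.
  by rewrite mule_ge0// lee_fin ?facet_density_ge0.
have F := ae_filter_ringOfSetsType (@lebesgue_rV R n.+1).
apply: (@filterS _ _ F _ _ _ ae_active_unique) => x xuniq _.
rewrite patchE in_setI.
have [xB|/negP xB] := boolP (x \in (punctured_ball : set 'rV[R]_n.+1)); last first.
  rewrite andbF big1// => j _; rewrite /facet_density.
  have [/andP[xB' _]|_] := boolP (_ && active w x j); last by rewrite mul0r mule0.
  by exfalso; apply: xB; rewrite inE.
have xB' : 0 < enorm x <= 1 by move: xB; rewrite inE.
have x0 : x != 0 by rewrite -enorm_gt0; case/andP: xB'.
(* Off the null set, the sum reduces to the one active facet [j0]; what remains is to match the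
   radial function and the membership in [eta]. *)
have [j0 xj0] := exists_active wpos x0.
rewrite andbT (bigD1 j0)//= big1 ?adde0; last first.
  move=> j jj0; rewrite /facet_density xB'/=; have [xj|_] := boolP (active w x j).
    by rewrite (xuniq _ _ xj xj0) eqxx in jj0.
  by rewrite mul0r mule0.
have d0 : 0 < (enorm x)^-1 by rewrite invr_gt0 enorm_gt0.
have dx0 : direction x != 0 by rewrite scaler_eq0 negb_or x0 gt_eqF.
rewrite facet_density_gauge xB' xj0 mul1r.
have -> : (enorm x / gauge w x) `^ q = (gauge w (direction x))^-1 `^ q.
  by rewrite gaugeZ ?ltW// invfM invrK.
have -> : (x \in direction @^-1` D) = (direction (w j0) \in eta).
  have dj0 : active w (direction x) j0 by rewrite activeZ.
  have N := outer_unit_normal_facet wpos _ dx0 dj0.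
  have {}N v : outer_unit_normal (polytope w) (boundary_point w (direction x)) v <->
      v = direction (w j0).
    by apply: N => k; rewrite activeZ// => xk; exact: xuniq.
  apply/idP/idP => /set_mem H; apply/mem_set.
    by case: H => _ [v [etav /N]] <-.
  split; first by rewrite /sphere /= enorm_direction.
  by exists (direction (w j0)); split => //; apply/N.
by case: ifP => _; rewrite ?mul1e ?mul0e.
Qed.

End facet_weight.

(** * Symmetric convex bodies and the symmetries of facet weights *)

Section polytope_body.
Context {R : realType} {n : nat} {J : finType}.
Implicit Types w : J -> 'rV[R]_n.

Lemma closed_polytope w : closed (polytope w).
Proof.
rewrite (_ : polytope w = \bigcap_(j in [set: J]) [set x | dotp x (w j) <= 1]).
  apply: closed_bigI => j _.
  have /continuous_closedP/(_ [set y : R | y <= 1]) := @continuous_dotp R n (w j).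
  by apply; exact: closed_le.
by apply/seteqP; split => [x Kx j _|x Kx j]; [exact: Kx | exact: (Kx j I)].
Qed.

Lemma convex_body_polytope w (M : R) :
  (forall x, polytope w x -> forall i, `|x ord0 i| <= M) ->
  convex_body (polytope w).
Proof.
move=> KM; split.
- have cM : compact [set x : 'rV[R]_n | forall i, `[- M, M]%classic (x ord0 i)].
    by apply: (@rV_compact _ _ (fun=> `[- M, M]%classic)) => i; exact: segment_compact.
  apply: (subclosed_compact (@closed_polytope w) cM) => x /KM H i.
  by rewrite /= in_itv /= -ler_norml.
- move=> x y l /set_mem Kx /set_mem Ky; apply/mem_set => j.
  rewrite dotpDl !dotpZl -[unstable.onem _]/(1 - l%:num).
  have l0 : 0 <= l%:num by [].
  have l1 : 0 <= 1 - l%:num by rewrite subr_ge0.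
  have := ler_wpM2l l0 (Kx j); have := ler_wpM2l l1 (Ky j); lra.
- exists 0; rewrite /interior /=.
  have H j : \forall x \near (0 : 'rV[R]_n), dotp x (w j) <= 1.
    have c0 : dotp x (w j) @[x --> (0 : 'rV[R]_n)] --> dotp 0 (w j).
      exact: (@continuous_dotp R n (w j) 0).
    by apply: (cvgr_le _ c0); rewrite dotp0l.
  exact: (filter_forall _ H).
Qed.

Lemma origin_symmetric_polytope w (f : J -> J) :
  (forall j, w (f j) = - w j) -> origin_symmetric (polytope w).
Proof.
move=> fN; have KN x : polytope w x -> polytope w (- x).
  by move=> Kx j; rewrite dotpNl dotpC -dotpNl -fN dotpC.
apply/seteqP; split => [x Kx|_ [x Kx <-]]; last exact: KN.
by exists (- x); [exact: KN | rewrite opprK].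
Qed.

End polytope_body.

(** A measure and norm preserving [Q] that matches the forms through [p] carries the cone over one
    facet to the cone over the other. The right inverse [p'] ensures that the comparison runs over
    all forms of [w']. Applied to the exchange of two coordinates and to [x -> - x]. *)
Lemma facet_weight_isometry (R : realType) n (J : finType) (q : R)
    (w w' : J -> 'rV[R]_n.+1) (Q : 'rV[R]_n.+1 -> 'rV[R]_n.+1) (p p' : J -> J) j :
  (forall f : 'rV[R]_n.+1 -> \bar R, measurable_fun setT f -> (forall x, 0 <= f x)%E ->
     (\int[lebesgue_rV n.+1]_x f x = \int[lebesgue_rV n.+1]_x f (Q x))%E) ->
  (forall x, x != 0 -> exists k, 0 < dotp x (w' k)) ->
  (forall x, enorm (Q x) = enorm x) ->
  cancel p' p ->
  (forall x k, dotp (Q x) (w' (p k)) = dotp x (w k)) ->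
  facet_weight q w' (p j) = facet_weight q w j.
Proof.
move=> intQ w'pos enQ pK dQ; rewrite /facet_weight intQ; last 2 first.
- by apply/measurable_EFinP; exact: measurable_facet_density.
- by move=> x; rewrite lee_fin facet_density_ge0.
apply: eq_integral => x _; congr EFin; rewrite /facet_density enQ dQ.
congr (((_ && _) : bool)%:R * _); apply/activeP/activeP => H k.
  by rewrite -!dQ.
by rewrite -(pK k) !dQ.
Qed.

Lemma swap01K (R : realType) m : involutive (@swap01 R m).
Proof. by move=> x; apply/rowP => i; rewrite !mxE tpermK. Qed.

Lemma dotp_swap01 (R : realType) m (x y : 'rV[R]_m.+2) :
  dotp (swap01 x) (swap01 y) = dotp x y.
Proof.
rewrite [RHS](reindex_inj (@perm_inj _ (tperm ord0 (lift ord0 ord0)))).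
by apply: eq_bigr => i _; rewrite !mxE.
Qed.

Lemma enorm_swap01 (R : realType) m (x : 'rV[R]_m.+2) : enorm (swap01 x) = enorm x.
Proof. by rewrite /enorm dotp_swap01. Qed.

Lemma swap01Z (R : realType) m a (x : 'rV[R]_m.+2) : swap01 (a *: x) = a *: swap01 x.
Proof. by apply/rowP => i; rewrite !mxE. Qed.

(** * The truncated box *)

Section truncated_box.
Context {R : realType} {m : nat}.
Implicit Types (c : R) (k : 'I_m.+2) (x : 'rV[R]_m.+2) (j : option 'I_m.+2 * bool).

Let i1 : 'I_m.+2 := lift ord0 ord0.

(** Reciprocal of the half-width of the box along axis [k]. *)
Definition axis_weight k : R := if k == ord0 then 2^-1 else 1.

(** [None] stands for the slab, [Some k] for a pair of opposite faces of the box; the sign is added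
    in [box_form]. *)
Definition facet_form c (o : option 'I_m.+2) : 'rV[R]_m.+2 :=
  if o is Some k then axis_weight k *: delta_mx ord0 k
  else c^-1 *: (delta_mx ord0 ord0 + delta_mx ord0 i1).

(* [polytope (box_form c)] is the box |x_0| <= 2, |x_k| <= 1 truncated by the
   slab |x_0 + x_1| <= c. *)
Definition box_form c j : 'rV[R]_m.+2 := (-1) ^+ j.2 *: facet_form c j.1.

Definition flip j := (j.1, ~~ j.2).

Lemma box_form_flip c j : box_form c (flip j) = - box_form c j.
Proof. by rewrite /box_form /= signrN scaleNr. Qed.

Lemma axis_weight_gt0 k : 0 < axis_weight k.
Proof. by rewrite /axis_weight; case: ifP => _; rewrite ?invr_gt0. Qed.

Lemma axis_weight0 : axis_weight ord0 = 2^-1. Proof. by []. Qed.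

Lemma axis_weight1 : axis_weight i1 = 1. Proof. by []. Qed.

Lemma dotp_delta x k : dotp x (delta_mx ord0 k) = x ord0 k.
Proof.
rewrite /dotp (bigD1 k)//= big1 ?addr0 => [|i ik]; first by rewrite mxE !eqxx mulr1.
by rewrite mxE (negbTE ik) andbF mulr0.
Qed.

Lemma dotp_facet_some c x k : dotp x (facet_form c (Some k)) = axis_weight k * x ord0 k.
Proof. by rewrite dotpZr dotp_delta. Qed.

Lemma dotp_facet_none c x :
  dotp x (facet_form c None) = c^-1 * (x ord0 ord0 + x ord0 i1).
Proof. by rewrite dotpZr dotpC dotpDl !(dotpC _ x) !dotp_delta. Qed.

Lemma signr_ler_norml (t M : R) : (forall s : bool, (-1) ^+ s * t <= M) <-> `|t| <= M.
Proof.
rewrite ler_norml lerNl; split => [H|/andP[tM Mt] []]; last 2 first.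
- by rewrite expr1 mulN1r.
- by rewrite expr0 mul1r.
by have := H true; have := H false; rewrite expr0 expr1 mul1r mulN1r => -> ->.
Qed.

Lemma polytope_boxP c x :
  polytope (box_form c) x <-> forall o, `|dotp x (facet_form c o)| <= 1.
Proof.
split => [Kx o|Kx [ o s]].
  by apply/signr_ler_norml => s; have := Kx (o, s); rewrite dotpZr.
by rewrite dotpZr; exact: (signr_ler_norml _ _).2.
Qed.

Lemma active_boxP c x o (s : bool) : reflect
  (forall o', `|dotp x (facet_form c o')| <= (-1) ^+ s * dotp x (facet_form c o))
  (active (box_form c) x (o, s)).
Proof.
apply: (iffP (activeP _ _ _)) => [H o'|H [ o' s']].
  by apply/signr_ler_norml => s'; have := H (o', s'); rewrite !dotpZr.
by rewrite !dotpZr; exact: (signr_ler_norml _ _).2.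
Qed.

Lemma box_form_pos c x : x != 0 -> exists j, 0 < dotp x (box_form c j).
Proof.
move=> x0; have [k xk] : exists k, x ord0 k != 0.
  apply/existsP; apply: contraNT x0; rewrite negb_exists => /forallP H.
  by apply/eqP/rowP => k; have := H k; rewrite negbK mxE => /eqP.
exists (Some k, x ord0 k < 0); rewrite dotpZr dotp_facet_some mulrCA.
by rewrite pmulr_rgt0 ?axis_weight_gt0// -normrEsign normr_gt0.
Qed.

Lemma facet_form_neq0 c o k : c != 0 -> (facet_form c o ord0 k != 0) =
  if o is Some k' then k == k' else (k == ord0) || (k == i1).
Proof.
move=> c0; case: o => [k'|]; rewrite !mxE !eqxx /= mulf_eq0 negb_or.
  by rewrite gt_eqF ?axis_weight_gt0//=; case: (k == k'); rewrite ?oner_eq0 ?eqxx.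
rewrite invr_eq0 c0 /= -natrD pnatr_eq0.
by have [->|_] := eqVneq k ord0; case: (_ == i1).
Qed.

(** The support of a form reveals its index: one coordinate for an axis, two for the slab. A nonzero
    entry then reveals the sign. *)
Lemma box_form_inj c : c != 0 -> injective (box_form c).
Proof.
move=> c0 [ o s] [ o' s'] E.
have supp k : (facet_form c o ord0 k != 0) = (facet_form c o' ord0 k != 0).
  have /rowP/(_ k) := E; rewrite !mxE /= => {}E; apply/idP/idP => H.
    by have := mulf_neq0 (negbT (signr_eq0 R s)) H; rewrite E mulf_eq0 negb_or => /andP[].
  by have := mulf_neq0 (negbT (signr_eq0 R s')) H; rewrite -E mulf_eq0 negb_or => /andP[].
have oo' : o = o'.
  case: o o' supp {E} => [k|] [k'|]// supp.
  - by have := supp k; rewrite !facet_form_neq0// eqxx => /esym/eqP ->.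
  - have := supp ord0; rewrite !facet_form_neq0// eqxx => /eqP k0.
    by have := supp i1; rewrite !facet_form_neq0// eqxx orbT -k0.
  - have := supp ord0; rewrite !facet_form_neq0// eqxx => /esym/eqP k0.
    by have := supp i1; rewrite !facet_form_neq0// eqxx orbT -k0.
subst o'; congr (_, _).
pose k := if o is Some k then k else ord0.
have nz : facet_form c o ord0 k != 0 by rewrite facet_form_neq0// /k; case: (o) => *; rewrite eqxx.
have /rowP/(_ k) := E; rewrite !mxE /= => /(mulIf nz) /eqP.
by rewrite (inj_eq (@signr_inj _)) => /eqP.
Qed.

Lemma box_form_bounded c x : polytope (box_form c) x -> forall k, `|x ord0 k| <= 2.
Proof.
move=> /polytope_boxP Kx k; have := Kx (Some k); rewrite dotp_facet_some normrM.
rewrite gtr0_norm ?axis_weight_gt0// /axis_weight; case: ifP => _; lra.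
Qed.

End truncated_box.

(** * Axis facet weights and their continuity in the truncation *)

Section axis_facets.
Context {R : realType} {m : nat}.
Variable q : R.
Hypothesis q_ge0 : 0 <= q.
Implicit Types (c : R) (i k : 'I_m.+2) (x : 'rV[R]_m.+2).

Let i1 : 'I_m.+2 := lift ord0 ord0.
Let mu := @lebesgue_rV R m.+2.

Definition in_axis_cone i x :=
  [forall k, `|axis_weight k * x ord0 k| <= axis_weight i * x ord0 i :> R].

(* For [c > 0] this is the density of the facet of the truncated box with
   normal [e_i]; unlike [box_form c] it does not degenerate at [c = 0]. *)
Definition axis_density i c x : R :=
  ((0 < enorm x <= 1) && in_axis_cone i x &&
   (`|x ord0 ord0 + x ord0 i1| <= c * (axis_weight i * x ord0 i)))%:R *
  (enorm x / (axis_weight i * x ord0 i)) `^ q.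

Definition axis_facet_weight i c : \bar R := (\int[mu]_x (axis_density i c x)%:E)%E.

Lemma facet_density_axis i c x : 0 < c ->
  facet_density q (box_form c) (Some i, false) x = axis_density i c x.
Proof.
move=> c0; rewrite /facet_density /axis_density dotpZr expr0 mul1r dotp_facet_some -[in RHS]andbA.
congr (((_ && _) : bool)%:R * _).
have H2 : (`|dotp x (facet_form c None)| <= axis_weight i * x ord0 i) =
    (`|x ord0 ord0 + x ord0 i1| <= c * (axis_weight i * x ord0 i)).
  rewrite dotp_facet_none normrM gtr0_norm ?invr_gt0// mulrC ler_pdivrMr//.
  by rewrite [in RHS]mulrC.
rewrite -H2; apply/idP/andP => [/active_boxP|[/forallP H1 {}H2]]; last first.
  by apply/active_boxP => -[k|]; rewrite !dotp_facet_some expr0 mul1r.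
rewrite dotp_facet_some expr0 mul1r => H; split => //.
by apply/forallP => k; have := H (Some k); rewrite dotp_facet_some.
Qed.

Lemma axis_cone_ge0 i x : in_axis_cone i x -> 0 <= axis_weight i * x ord0 i.
Proof. by move=> /forallP/(_ i); exact: le_trans. Qed.

Lemma axis_cone_coord i x k : in_axis_cone i x ->
  `|x ord0 k| <= 2 * (axis_weight i * x ord0 i).
Proof.
move=> /forallP/(_ k); rewrite normrM gtr0_norm ?axis_weight_gt0// {1}/axis_weight.
have := normr_ge0 (x ord0 k); case: ifP => _; lra.
Qed.

Lemma axis_cone_gt0 i x : in_axis_cone i x -> x != 0 -> 0 < x ord0 i.
Proof.
move=> ix x0; have := axis_cone_ge0 ix; rewrite pmulr_rge0 ?axis_weight_gt0//.
rewrite le_eqVlt => /predU1P[xi|//]; exfalso; move/eqP: x0; apply.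
apply/rowP => k; rewrite mxE; apply/eqP; rewrite -normr_eq0 eq_le normr_ge0 andbT.
by have := axis_cone_coord k ix; rewrite -xi !mulr0.
Qed.

Lemma axis_density_ge0 i c x : 0 <= axis_density i c x.
Proof. by rewrite mulr_ge0// powR_ge0. Qed.

(** In the cone every coordinate is at most twice [axis_weight i * x ord0 i] in absolute value, so
    the quotient is at most [sqrt (4 * m.+2)]. The bound is uniform in [c], as dominated convergence
    requires. *)
Lemma axis_density_le i c x : axis_density i c x <=
  (0 < enorm x <= 1)%R%:R * (Num.sqrt (4 * m.+2%:R)) `^ q.
Proof.
rewrite /axis_density; have [|_] := boolP (_ && in_axis_cone i x && _); last first.
  by rewrite mul0r mulr_ge0// powR_ge0.
move=> /andP[/andP[xB ix] _]; rewrite xB !mul1r.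
have x0 : x != 0 by rewrite -enorm_gt0; case/andP: xB.
have xi := axis_cone_gt0 ix x0.
set l := axis_weight i * x ord0 i.
have l0 : 0 < l by rewrite mulr_gt0// axis_weight_gt0.
apply: ge0_ler_powR; rewrite ?nnegrE ?sqrtr_ge0//.
  by apply: divr_ge0; [exact: enorm_ge0 | exact: ltW].
rewrite ler_pdivrMr// -[X in _ * X]gtr0_norm// -sqrtr_sqr -sqrtrM ?mulr_ge0//.
apply: ler_wsqrtr; rewrite /dotp.
have -> : 4 * m.+2%:R * l ^+ 2 = \sum_(k < m.+2) (2 * l) ^+ 2.
  by rewrite sumr_const card_ord -[RHS]mulr_natl; ring.
apply: ler_sum => k _; rewrite -expr2 -real_normK ?num_real//.
by apply: lerXn2r; rewrite ?nnegrE//; [rewrite mulr_ge0// ltW | exact: axis_cone_coord].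
Qed.

Lemma measurable_axis_form i : measurable_fun setT (fun x => axis_weight i * x ord0 i).
Proof. by apply: measurable_funM => //; exact: measurable_coord. Qed.

Lemma measurable_in_axis_cone i : measurable_fun setT (in_axis_cone i).
Proof.
rewrite (_ : in_axis_cone i = fun x => \big[andb/true]_k
    (`|axis_weight k * x ord0 k| <= axis_weight i * x ord0 i)).
  elim: (index_enum _) => [|k s IH].
    by under eq_fun do rewrite big_nil; exact: measurable_cst.
  under eq_fun do rewrite big_cons.
  apply: measurable_and => //; apply: measurable_fun_ler; last exact: measurable_axis_form.
  by apply: measurableT_comp => //; exact: measurable_axis_form.
by apply/funext => x; rewrite big_andE.
Qed.

Lemma measurable_punctured : measurable_fun setT (fun x => 0 < enorm x <= 1).
Proof.
apply: measurable_and; first by apply: measurable_fun_ltr => //; exact: measurable_enorm.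
by apply: measurable_fun_ler => //; exact: measurable_enorm.
Qed.

Lemma measurable_axis_density i c : measurable_fun setT (axis_density i c).
Proof.
(* The absolute value changes nothing inside the cone and makes the denominator nonnegative
   everywhere. *)
rewrite (_ : axis_density i c = fun x => ((0 < enorm x <= 1) && in_axis_cone i x &&
   (`|x ord0 ord0 + x ord0 i1| <= c * (axis_weight i * x ord0 i)))%:R *
  (enorm x / `|axis_weight i * x ord0 i|) `^ q); last first.
  apply/funext => x; rewrite /axis_density.
  have [/andP[/andP[_ ix] _]|_] := boolP (_ && in_axis_cone i x && _); last by rewrite !mul0r.
  by rewrite (ger0_norm (axis_cone_ge0 ix)).
apply: measurable_funM.
  apply: measurable_boolr; apply: measurable_and.
    by apply: measurable_and; [exact: measurable_punctured | exact: measurable_in_axis_cone].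
  apply: measurable_fun_ler.
    apply: measurableT_comp => //.
    by apply: measurable_funD; exact: measurable_coord.
  by apply: measurable_funM => //; exact: measurable_axis_form.
apply: (measurableT_comp (measurable_powR q)).
apply: measurable_funM; first exact: measurable_enorm.
apply: measurable_funV_ge0 => //.
by apply: measurableT_comp => //; exact: measurable_axis_form.
Qed.

Lemma integrable_axis_bound : mu.-integrable setT
  (fun x => ((0 < enorm x <= 1)%R%:R * (Num.sqrt (4 * m.+2%:R)) `^ q)%:E).
Proof.
set M := _ `^ q.
have M0 : 0 <= M by exact: powR_ge0.
have mb : measurable_fun setT (fun x : 'rV[R]_m.+2 => (0 < enorm x <= 1)%R%:R * M).
  by apply: measurable_funM => //; apply: measurable_boolr; exact: measurable_punctured.
apply/integrableP; split; first exact/measurable_EFinP.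
rewrite (eq_integral (fun x => M%:E * (\1_(@punctured_ball R m.+2) x)%:E)%E).
  rewrite ge0_integralZl_EFin; last 4 first.
  - exact: measurableT.
  - by move=> x _; rewrite lee_fin.
  - by apply/measurable_EFinP; apply: measurable_indic; exact: measurable_punctured_ball.
  - exact: M0.
  rewrite integral_indic ?setIT//; last exact: measurable_punctured_ball.
  by apply: lte_mul_pinfty => //; exact: lebesgue_rV_punctured_ball.
move=> x _; rewrite -EFinM /= ger0_norm ?mulr_ge0// mulrC; congr (_ * (_ : bool)%:R)%:E.
by apply/idP/idP => H; [apply/mem_set | exact: set_mem H].
Qed.

Lemma axis_facet_weight_fin i c : axis_facet_weight i c \is a fin_num.
Proof.
apply: integrable_fin_num => //; apply: (le_integrable _ _ _ integrable_axis_bound) => //.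
  by apply/measurable_EFinP; exact: measurable_axis_density.
move=> x _; rewrite /= lee_fin !ger0_norm ?axis_density_ge0 ?mulr_ge0 ?powR_ge0//.
exact: axis_density_le.
Qed.

Lemma ae_dotp_neq0 (v : 'rV[R]_m.+2) : v != 0 -> {ae mu, forall x, dotp x v != 0}.
Proof.
move=> v0; exists [set x | dotp x v = 0]; split.
- exact: measurable_hyperplane.
- exact: lebesgue_rV_hyperplane.
- by move=> x /= /negP; rewrite negbK => /eqP.
Qed.

(** Equality places [x] on one of two hyperplanes, one for each sign of the coordinate sum. Their
    normals [v s] are nonzero since [i] is one of the first two axes: the entry of [v s] at the
    other one is 1. *)
Lemma ae_slab_boundary i c : (i == ord0) || (i == i1) ->
  {ae mu, forall x, `|x ord0 ord0 + x ord0 i1| != c * (axis_weight i * x ord0 i)}.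
Proof.
move=> i01.
pose v (s : R) : 'rV[R]_m.+2 := delta_mx ord0 ord0 + delta_mx ord0 i1 -
    (s * axis_weight i) *: delta_mx ord0 i.
have v0 s : v s != 0.
  pose k := if i == ord0 then i1 else ord0.
  apply/eqP => /rowP/(_ k); rewrite !mxE !eqxx /= /k.
  by case/orP: i01 => /eqP -> /=; rewrite ?mulr0 ?subr0 ?addr0 ?add0r => /eqP; rewrite oner_eq0.
have F := ae_filter_ringOfSetsType mu.
apply: (@filterS2 _ _ F _ _ _ _ (ae_dotp_neq0 (v0 c)) (ae_dotp_neq0 (v0 (- c)))) => x.
have E s : dotp x (v s) = x ord0 ord0 + x ord0 i1 - s * (axis_weight i * x ord0 i).
  by rewrite dotpBr dotpZr dotpC dotpDl !(dotpC _ x) !dotp_delta mulrA.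
rewrite !E => H1 H2; apply/eqP => H; move: H1 H2; rewrite -H mulNr -H opprK.
have [_|_] := ger0P (x ord0 ord0 + x ord0 i1); first by rewrite subrr eqxx.
by rewrite subrr eqxx.
Qed.

(** Dominated convergence along sequences: off the null set of [ae_slab_boundary], the slab
    condition is strictly satisfied or strictly violated, so the density is eventually constant. *)
Lemma continuous_axis_facet_weight i : (i == ord0) || (i == i1) ->
  continuous (fun c => fine (axis_facet_weight i c)).
Proof.
move=> i01 c; apply/(@cvg_nbhsP _ R^o) => u uc.
apply: fine_cvg; rewrite fineK ?axis_facet_weight_fin//.
have F := ae_filter_ringOfSetsType mu.
set g := fun x => ((0 < enorm x <= 1)%R%:R * (Num.sqrt (4 * m.+2%:R)) `^ q)%:E.
have md c' : measurable_fun setT (fun x => (axis_density i c' x)%:E).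
  by apply/measurable_EFinP; exact: measurable_axis_density.
have aecvg : {ae mu, forall x, setT x ->
    (axis_density i (u n) x)%:E @[n --> \oo] --> (axis_density i c x)%:E}.
  apply: (@filterS _ _ F _ _ _ (ae_slab_boundary c i01)) => x xc _.
  set l := axis_weight i * x ord0 i in xc *.
  have ul : u n * l @[n --> \oo] --> c * l by apply: cvgM => //; exact: cvg_cst.
  apply: cvg_near_cst.
  have [clt|cgt|/eqP] := ltgtP `|x ord0 ord0 + x ord0 i1| (c * l); last by rewrite (negbTE xc).
    near=> n; have ulx : `|x ord0 ord0 + x ord0 i1| < u n * l.
      by near: n; exact: (cvgr_gt _ ul _ clt).
    by rewrite /axis_density -/l (ltW ulx) (ltW clt).
  near=> n; have ulx : u n * l < `|x ord0 ord0 + x ord0 i1|.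
    by near: n; exact: (cvgr_lt _ ul _ cgt).
  by rewrite /axis_density -/l ![`|x ord0 ord0 + _| <= _]leNgt ulx cgt.
have aebound : {ae mu, forall x (n : nat), setT x -> (`|(axis_density i (u n) x)%:E| <= g x)%E}.
  apply: (@aeW _ _ _ mu) => x n _ /=.
  by rewrite lee_fin ger0_norm ?axis_density_ge0//; exact: axis_density_le.
by have [] := dominated_convergence measurableT (fun n => md (u n)) (md c)
  aecvg integrable_axis_bound aebound.
Unshelve. all: by end_near. Qed.

End axis_facets.

(** * The extreme truncations *)

Section stretch.
Context {R : realType} {m : nat}.
Implicit Types (k : 'I_m.+2) (x : 'rV[R]_m.+2).

Let i1 : 'I_m.+2 := lift ord0 ord0.
Let mu := @lebesgue_rV R m.+2.

(** Composed so that the Jacobians 1/2 and 2 of the two dilations cancel. *)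
Definition stretch x : 'rV[R]_m.+2 := scale0 2 (swap01 (scale0 2^-1 x)).

Lemma stretch0 x : stretch x ord0 ord0 = 2 * x ord0 i1.
Proof. by rewrite !mxE tpermL /= mul1r. Qed.

Lemma stretch1 x : stretch x ord0 i1 = 2^-1 * x ord0 ord0.
Proof. by rewrite !mxE tpermR /= mul1r. Qed.

Lemma stretch_ge2 x (k : 'I_m) :
  stretch x ord0 (lift ord0 (lift ord0 k)) = x ord0 (lift ord0 (lift ord0 k)).
Proof.
by rewrite !mxE tpermD ?mul1r// -?(inj_eq (@lift_inj _ ord0)) ?(inj_eq lift_inj) neq_lift.
Qed.

Lemma measurable_stretch : measurable_fun setT stretch.
Proof.
apply: (measurableT_comp (@measurable_scale0 _ _ _)).
by apply: (measurableT_comp (@measurable_swap01 _ _)); exact: measurable_scale0.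
Qed.

Lemma stretchZ (a : R) x : stretch (a *: x) = a *: stretch x.
Proof. by apply/rowP => i; rewrite !mxE; ring. Qed.

Lemma ge0_integral_stretch (f : 'rV[R]_m.+2 -> \bar R) :
  measurable_fun setT f -> (forall x, 0 <= f x)%E ->
  (\int[mu]_x f x = \int[mu]_x f (stretch x))%E.
Proof.
move=> mf f0.
have n2 : 2 != 0 :> R by rewrite pnatr_eq0.
rewrite (ge0_integral_scale0 n2 mf f0).
have mf2 := measurableT_comp mf (@measurable_scale0 R m.+1 2).
rewrite (ge0_integral_swap01 mf2 (fun x => f0 _)).
have mf3 := measurableT_comp mf2 (@measurable_swap01 R m).
rewrite (ge0_integral_scale0 (invr_neq0 n2) mf3 (fun x => f0 _)).
by rewrite muleA -EFinM -normrM divff// normr1 mul1e.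
Qed.

Lemma dotp_split x : dotp x x = x ord0 ord0 ^+ 2 + x ord0 i1 ^+ 2 +
  \sum_(k < m) x ord0 (lift ord0 (lift ord0 k)) ^+ 2.
Proof.
by rewrite /dotp !big_ord_recl /= -!expr2 addrA.
Qed.

Lemma stretch_eq0 x : (stretch x == 0) = (x == 0).
Proof.
apply/idP/idP => [|/eqP ->]; last first.
  by have := stretchZ 0 0; rewrite !scale0r => ->.
rewrite -!dotpxx_eq0 !dotp_split stretch0 stretch1.
under eq_bigr do rewrite stretch_ge2.
set S := \sum_(k < m) _.
have S0 : 0 <= S by apply: sumr_ge0 => k _; rewrite sqr_ge0.
have := sqr_ge0 (x ord0 ord0); have := sqr_ge0 (x ord0 i1) => a0 b0 /eqP E.
by apply/eqP; lra.
Qed.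

(** [stretch] exchanges the weighted coordinates [x_0 / 2] and [x_1] and fixes the others, so it
    permutes the quantities compared in the cone condition. *)
Lemma in_axis_cone_stretch x : in_axis_cone i1 (stretch x) = in_axis_cone ord0 x.
Proof.
have E0 : axis_weight (ord0 : 'I_m.+2) * stretch x ord0 ord0 = axis_weight i1 * x ord0 i1.
  by rewrite stretch0 axis_weight0 axis_weight1 mulrA mulVf ?mul1r// pnatr_eq0.
have E1 : axis_weight i1 * stretch x ord0 i1 = axis_weight (ord0 : 'I_m.+2) * x ord0 ord0.
  by rewrite stretch1 axis_weight0 axis_weight1 mul1r.
rewrite /in_axis_cone E1; apply/forallP/forallP => H k.
  have [k' ->|->] := unliftP ord0 k; last by have := H i1; rewrite E1.
  have [k'' ->|->] := unliftP ord0 k'; last by have := H ord0; rewrite E0.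
  by have := H (lift ord0 (lift ord0 k'')); rewrite stretch_ge2.
have [k' ->|->] := unliftP ord0 k; last by rewrite E0.
have [k'' ->|->] := unliftP ord0 k'; last by rewrite E1.
by rewrite stretch_ge2.
Qed.

(** The inequality [4 x_1^2 + x_0^2 / 4 <= x_0^2 + x_1^2] amounts to [x_1^2 <= (x_0 / 2)^2], which
    the cone gives. *)
Lemma enorm_stretch_le x : in_axis_cone ord0 x -> enorm (stretch x) <= enorm x.
Proof.
move=> /forallP/(_ i1); rewrite axis_weight0 axis_weight1 mul1r => x10.
apply: ler_wsqrtr; rewrite !dotp_split stretch0 stretch1.
under eq_bigr do rewrite stretch_ge2.
rewrite lerD2r.
have x0 : 0 <= 2^-1 * x ord0 ord0 by exact: le_trans x10.
have : x ord0 i1 ^+ 2 <= (2^-1 * x ord0 ord0) ^+ 2.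
  rewrite -real_normK ?num_real//; apply: lerXn2r; rewrite ?nnegrE//.
lra.
Qed.

End stretch.

Section extreme_truncations.
Context {R : realType} {m : nat}.
Variable q : R.
Hypothesis q_gt : m.+2%:R < q.
Implicit Types (k : 'I_m.+2) (x : 'rV[R]_m.+2).

Let i1 : 'I_m.+2 := lift ord0 ord0.
Let mu := @lebesgue_rV R m.+2.
Let q_ge0 : 0 <= q. Proof. by rewrite (le_trans _ (ltW q_gt)). Qed.

(** The cone gives [x_1 >= - x_0 / 2] and the slab [x_0 + x_1 <= x_0 / 2]; together they confine [x]
    to the hyperplane [x_0 / 2 + x_1 = 0]. *)
Lemma axis_facet_weight_0_1 : axis_facet_weight q (ord0 : 'I_m.+2) 1 = 0%E.
Proof.
pose v : 'rV[R]_m.+2 := 2^-1 *: delta_mx ord0 ord0 + delta_mx ord0 i1.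
have v0 : v != 0.
  by apply/eqP => /rowP/(_ i1); rewrite !mxE eqxx /= mulr0 add0r => /eqP; rewrite oner_eq0.
rewrite -(integral0 mu setT); apply: ge0_ae_eq_integral => //.
- by apply/measurable_EFinP; exact: measurable_axis_density.
- by move=> x _; rewrite lee_fin axis_density_ge0.
have F := ae_filter_ringOfSetsType mu.
apply: (@filterS _ _ F _ _ _ (ae_dotp_neq0 v0)) => x xv _; congr EFin.
rewrite /axis_density; have [/andP[/andP[_ /forallP/(_ i1)]]|_] :=
    boolP (_ && in_axis_cone _ x && _);
  last by rewrite mul0r.
rewrite axis_weight0 axis_weight1 !mul1r !ler_norml => /andP[h1 _] /andP[_ h2].
exfalso; move: xv; rewrite dotpC dotpDl dotpZl !(dotpC _ x) !dotp_delta => /eqP; apply; lra.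
Qed.

Let radial_mass : \bar R :=
  (\int[lebesgue_measure]_r (((0 < r) && (r <= 1))%R%:R * `|r| ^+ m.+1)%:E)%E.

Let radius_integrand (h : 'rV[R]_m.+2 -> 'rV[R]_m.+2) x : R :=
  (in_axis_cone ord0 x)%:R * (2 * (enorm (h x) / `|x ord0 ord0|)) `^ q.

(** Gnomonic coordinates with [u x = |h x| / |x_0|], which is constant along rays: on the cone,
    [x_0 * u x <= 1] is the ball condition on [h x], and dividing by [u ^ m.+2] lowers the exponent
    from [q] to [q - m.+2]. Taking [h] to be the identity or [stretch] puts both facet weights in
    the same form. *)
Lemma integral_axis_cone (h : 'rV[R]_m.+2 -> 'rV[R]_m.+2) :
  measurable_fun setT h -> (forall a x, h (a *: x) = a *: h x) ->
  (forall x, (h x == 0) = (x == 0)) ->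
  (\int[mu]_x (((0 < enorm (h x) <= 1) && in_axis_cone ord0 x)%:R *
     (enorm (h x) / (2^-1 * x ord0 ord0)) `^ q)%:E =
   radial_mass *
   \int[lebesgue_rV m.+1]_s ((in_axis_cone ord0 (rV_cons (1, s)))%:R *
     (2 `^ q * enorm (h (rV_cons (1, s))) `^ (q - m.+2%:R)))%:E)%E.
Proof.
move=> mh hZ h0.
pose u x := enorm (h x) / `|x ord0 ord0|.
have mu' : measurable_fun setT u.
  apply: measurable_funM; first exact: (measurableT_comp (@measurable_enorm R m.+2) mh).
  apply: measurable_funV_ge0 => //; apply: measurableT_comp => //.
  exact: measurable_coord.
have cone1_neq0 (s : 'rV[R]_m.+1) : rV_cons (1, s) != 0 :> 'rV[R]_m.+2.
  by apply/eqP => /rowP/(_ ord0); rewrite rV_cons0 mxE => /eqP; rewrite oner_eq0.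
have hs0 (s : 'rV[R]_m.+1) : 0 < enorm (h (rV_cons (1, s))).
  by rewrite enorm_gt0 h0.
have uh r x : 0 < r -> u (r *: x) = u x.
  move=> r0; rewrite /u hZ enormZ mxE normrM invfM mulrACA divff ?mul1r//.
  by rewrite normr_eq0 gt_eqF.
have coneZ r x : 0 < r -> in_axis_cone ord0 (r *: x) = in_axis_cone ord0 x.
  move=> r0; apply: eq_forallb => k.
  by rewrite !mxE !(mulrCA _ r) [`|r * _|]normrM (gtr0_norm r0) ler_pM2l.
have := @integral_halfspace_cone R m.+1 u (radius_integrand h) mu' _ _ _ uh _.
move=> H; transitivity (\int[mu]_x
    (((0 < x ord0 ord0) && (x ord0 ord0 * u x <= 1))%:R * radius_integrand h x)%:E)%E.
  apply: eq_integral => x _; congr EFin; rewrite /radius_integrand.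
  have [cx|_] := boolP (in_axis_cone ord0 x); last by rewrite andbF !mul0r mulr0.
  rewrite andbT mul1r enorm_gt0 h0.
  have [x0|x0] := eqVneq x 0; first by rewrite x0 mxE ltxx !mul0r.
  have x00 := axis_cone_gt0 cx x0.
  rewrite x00 /u gtr0_norm// [x ord0 ord0 * _]mulrC divfK ?gt_eqF//= invfM invrK.
  by congr (_ * _ `^ q); ring.
rewrite H; last first.
- by move=> r x r0; rewrite /radius_integrand coneZ// -!/(u _) uh.
- by move=> s; rewrite /u rV_cons0 normr1 divr1.
- by move=> x; rewrite mulr_ge0// powR_ge0.
- apply: measurable_funM; first by apply: measurable_boolr; exact: measurable_in_axis_cone.
  by apply: (measurableT_comp (measurable_powR q)); exact: measurable_funM.
congr (_ * _)%E; apply: eq_integral => s _; congr EFin.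
rewrite /radius_integrand /u rV_cons0 normr1 divr1 -mulrA; congr (_ * _).
rewrite powRM// ?enorm_ge0// -mulrA; congr (_ * _).
rewrite powRB; last by rewrite (gt_eqF (hs0 _)) implybT.
by rewrite powR_mulrn// enorm_ge0.
Qed.

(** After pulling back by [stretch], the two integrals still run over different regions,
    [|stretch x| <= 1] and [|x| <= 1]. In gnomonic coordinates they share the slice of the cone and
    the radial factor, and [|stretch x| <= |x|] is raised to the positive power [q - m.+2]. *)
Lemma axis_facet_weight_3_le :
  (axis_facet_weight q i1 3 <= axis_facet_weight q (ord0 : 'I_m.+2) 3)%E.
Proof.
(* At truncation 3 the slab condition follows from [|x_1| <= x_0 / 2], before and after
   [stretch]. *)
have cone3 x : in_axis_cone ord0 x ->
    `|x ord0 ord0 + x ord0 i1| <= 3 * (2^-1 * x ord0 ord0) /\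
    `|2 * x ord0 i1 + 2^-1 * x ord0 ord0| <= 3 * (2^-1 * x ord0 ord0).
  move=> cx; have := axis_cone_ge0 cx; move: cx => /forallP/(_ i1).
  rewrite axis_weight0 axis_weight1 mul1r !ler_norml => /andP[h1 h2] h3.
  by split; apply/andP; split; lra.
rewrite [leLHS]ge0_integral_stretch; last 2 first.
- by apply/measurable_EFinP; exact: measurable_axis_density.
- by move=> x; rewrite lee_fin axis_density_ge0.
have -> : (\int[mu]_x (axis_density q i1 3 (stretch x))%:E =
    \int[mu]_x (((0 < enorm (stretch x) <= 1) && in_axis_cone ord0 x)%:R *
     (enorm (stretch x) / (2^-1 * x ord0 ord0)) `^ q)%:E)%E.
  apply: eq_integral => x _; congr EFin.
  rewrite /axis_density in_axis_cone_stretch stretch0 stretch1 axis_weight1 !mul1r.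
  have [/cone3[_ ->]|_] := boolP (in_axis_cone ord0 x); first by rewrite !andbT.
  by rewrite !andbF.
have -> : (axis_facet_weight q (ord0 : 'I_m.+2) 3 =
    \int[mu]_x (((0 < enorm x <= 1) && in_axis_cone ord0 x)%:R *
     (enorm x / (2^-1 * x ord0 ord0)) `^ q)%:E)%E.
  apply: eq_integral => x _; congr EFin; rewrite /axis_density axis_weight0.
  have [/cone3[-> _]|_] := boolP (in_axis_cone ord0 x); first by rewrite !andbT.
  by rewrite !andbF.
rewrite (integral_axis_cone (@measurable_stretch _ _) (@stretchZ _ _) (@stretch_eq0 _ _)).
have -> : (\int[mu]_x (((0 < enorm x <= 1) && in_axis_cone ord0 x)%:R *
     (enorm x / (2^-1 * x ord0 ord0)) `^ q)%:E =
   radial_mass * \int[lebesgue_rV m.+1]_s ((in_axis_cone ord0 (rV_cons (1, s)))%:R *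
     (2 `^ q * enorm (rV_cons (1, s)) `^ (q - m.+2%:R)))%:E)%E.
  exact: (@integral_axis_cone id (@measurable_id _ _ _) (fun _ _ => erefl) (fun _ => erefl)).
apply: lee_wpmul2l.
  by apply: integral_ge0 => r _; rewrite lee_fin mulr_ge0// exprn_ge0.
have mg (h : 'rV[R]_m.+2 -> 'rV[R]_m.+2) : measurable_fun setT h ->
    measurable_fun setT (fun s : 'rV[R]_m.+1 => ((in_axis_cone ord0 (rV_cons (1, s)))%:R *
     (2 `^ q * enorm (h (rV_cons (1, s))) `^ (q - m.+2%:R)))%:E).
  move=> mh; apply: (@measurable_rV_consl _ _ (fun x => ((in_axis_cone ord0 x)%:R *
     (2 `^ q * enorm (h x) `^ (q - m.+2%:R)))%:E)).
  apply/measurable_EFinP; apply: measurable_funM.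
    by apply: measurable_boolr; exact: measurable_in_axis_cone.
  apply: measurable_funM => //; apply: (measurableT_comp (measurable_powR _)).
  exact: (measurableT_comp (@measurable_enorm R m.+2) mh).
apply: ge0_le_integral; first exact: measurableT.
- by move=> s _; rewrite lee_fin; apply: mulr_ge0 => //; apply: mulr_ge0; exact: powR_ge0.
- by apply: mg; exact: measurable_stretch.
- exact: (mg id).
move=> s _; rewrite lee_fin.
have [cs|_] := boolP (in_axis_cone ord0 (rV_cons (1, s) : 'rV[R]_m.+2)); last by rewrite !mul0r.
rewrite !mul1r; apply: ler_wpM2l; first exact: powR_ge0.
by apply: ge0_ler_powR;
  rewrite ?nnegrE ?enorm_ge0//; [rewrite subr_ge0 ltW | exact: enorm_stretch_le].
Qed.

Lemma exists_balanced_truncation : exists2 c : R, 1 <= c <= 3 &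
  axis_facet_weight q (ord0 : 'I_m.+2) c = axis_facet_weight q i1 c.
Proof.
pose f c := fine (axis_facet_weight q (ord0 : 'I_m.+2) c) - fine (axis_facet_weight q i1 c).
have fin i c := axis_facet_weight_fin q_ge0 (i : 'I_m.+2) c.
have f1 : f 1 <= 0.
  rewrite /f axis_facet_weight_0_1 /= sub0r oppr_le0 fine_ge0//.
  by apply: integral_ge0 => x _; rewrite lee_fin axis_density_ge0.
have f3 : 0 <= f 3.
  by rewrite /f subr_ge0; apply: (fine_le (fin _ _) (fin _ _)); exact: axis_facet_weight_3_le.
have cf : {within `[1, 3], continuous f}.
  apply: continuous_subspaceT => c; apply: cvgB.
    by apply: (continuous_axis_facet_weight q_ge0); rewrite eqxx.
  by apply: (continuous_axis_facet_weight q_ge0); rewrite eqxx orbT.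
have [||c c13 fc] := IVT _ cf (v := 0); first by rewrite ler1n.
  by rewrite ge_min f1 /= le_max f3 orbT.
exists c; first by rewrite in_itv /= in c13.
by move/eqP: fc; rewrite /f subr_eq0 => /eqP E; rewrite -(fineK (fin _ _)) E fineK.
Qed.

End extreme_truncations.

(** * Comparison with the truncated box after exchange of two axes *)

Section swapped_truncated_box.
Context {R : realType} {m : nat}.
Variables (q c : R).
Hypothesis c_gt0 : 0 < c.
Implicit Types (k : 'I_m.+2) (x : 'rV[R]_m.+2) (j : option 'I_m.+2 * bool).

Let i1 : 'I_m.+2 := lift ord0 ord0.
Let c_neq0 : c != 0. Proof. by rewrite gt_eqF. Qed.

Definition swapped_form j : 'rV[R]_m.+2 := swap01 (box_form c j).

Lemma dotp_swapped x j : dotp x (swapped_form j) = dotp (swap01 x) (box_form c j).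
Proof. by rewrite -{1}(swap01K x) dotp_swap01. Qed.

Lemma polytope_swapped x : polytope swapped_form x <-> polytope (box_form c) (swap01 x).
Proof. by split => Kx j; have := Kx j; rewrite dotp_swapped. Qed.

Lemma swapped_form_pos x : x != 0 -> exists j, 0 < dotp x (swapped_form j).
Proof.
move=> x0; have [|j] := @box_form_pos R m c (swap01 x); last by exists j; rewrite dotp_swapped.
by rewrite -enorm_eq0 enorm_swap01 enorm_eq0.
Qed.

Lemma swapped_form_inj : injective swapped_form.
Proof. by move=> j j' /(can_inj (@swap01K _ _)) /(box_form_inj c_neq0). Qed.

Lemma facet_weight_swapped j :
  facet_weight q swapped_form j = facet_weight q (box_form c) j.
Proof.
apply: (@facet_weight_isometry _ _ _ _ _ _ swap01 id id) => //.
- exact: ge0_integral_swap01.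
- exact: swapped_form_pos.
- exact: enorm_swap01.
- by move=> x k; exact: dotp_swap01.
Qed.

Lemma facet_weight_flip j :
  facet_weight q (box_form c) (flip j) = facet_weight q (box_form c) j.
Proof.
apply: (@facet_weight_isometry _ _ _ _ _ _ (fun x => -1 *: x) flip flip).
- move=> f mf f0; have n1 : -1 != 0 :> R by rewrite oppr_eq0 oner_eq0.
  by rewrite (ge0_integral_rV_scale n1 mf f0) normrN1 expr1n mul1e.
- exact: box_form_pos.
- by move=> x; rewrite enormZ normrN1 mul1r.
- by move=> [ o s]; rewrite /flip /= negbK.
- by move=> x k; rewrite box_form_flip scaleN1r dotpNl dotpC dotpNl opprK dotpC.
Qed.

(** Matches the facets of the two bodies by their normal directions, see [direction_swapped]. *)
Definition swap_index j :=
  if j.1 is Some k then (Some (tperm ord0 i1 k), j.2) else j.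

Lemma swap_indexK : involutive swap_index.
Proof. by move=> [[k|] s]; rewrite /swap_index //= tpermK. Qed.

(** Sign flips reduce the claim to positive axes, where only the axes 0 and 1 trade places; their
    weights agree by assumption. *)
Lemma facet_weight_swap_index j :
  axis_facet_weight q (ord0 : 'I_m.+2) c = axis_facet_weight q i1 c ->
  facet_weight q (box_form c) (swap_index j) = facet_weight q (box_form c) j.
Proof.
move=> E; case: j => [[k|] s]; last exact: erefl.
rewrite -[swap_index _]/(Some (tperm ord0 i1 k), s).
have axis (i : 'I_m.+2) : facet_weight q (box_form c) (Some i, s) = axis_facet_weight q i c.
  transitivity (facet_weight q (box_form c) (Some i, false)).
    by case: s; [exact: (facet_weight_flip (Some i, false)) | exact: erefl].
  by apply: eq_integral => x _; rewrite facet_density_axis.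
rewrite !axis; case: tpermP => [->|->|_ _]; [exact: esym E | exact: E | exact: erefl].
Qed.

Lemma directionZ (a : R) x : 0 < a -> direction (a *: x) = direction x.
Proof.
move=> a0; rewrite /direction enormZ gtr0_norm// scalerA; congr (_ *: _).
by rewrite invfM mulrAC mulVf ?mul1r// gt_eqF.
Qed.

(** The exchange moves [axis_weight] along with its axis, so axis forms are matched only up to a
    positive factor, which [direction] removes. The slab form is fixed by the exchange. *)
Lemma direction_swapped j : direction (swapped_form j) = direction (box_form c (swap_index j)).
Proof.
case: j => [[k|] s]; rewrite /swapped_form /box_form /swap_index /= swap01Z.
  rewrite swap01Z !scalerA ![_ * axis_weight _]mulrC -!scalerA !(directionZ _ (axis_weight_gt0 _)).
  congr direction; apply/rowP => i; rewrite !mxE !eqxx /=; congr (_ * _%:R).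
  by rewrite -(inj_eq (@perm_inj _ (tperm ord0 i1))) tpermK.
congr direction; congr (_ *: _); rewrite swap01Z; congr (_ *: _).
apply/rowP => i; rewrite !mxE !eqxx /=.
by case: tpermP => [->|->|//]; rewrite eqxx addrC.
Qed.

Lemma convex_body_truncated_box : convex_body (polytope (box_form c : _ -> 'rV[R]_m.+2)).
Proof. exact: (convex_body_polytope (@box_form_bounded R m c)). Qed.

Lemma origin_symmetric_truncated_box :
  origin_symmetric (polytope (box_form c : _ -> 'rV[R]_m.+2)).
Proof. exact: (origin_symmetric_polytope (@box_form_flip R m c)). Qed.

Lemma convex_body_swapped : convex_body (polytope swapped_form).
Proof.
apply: (@convex_body_polytope _ _ _ _ 2) => x /polytope_swapped /box_form_bounded H i.
by have := H (tperm ord0 i1 i); rewrite mxE tpermK.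
Qed.

Lemma origin_symmetric_swapped : origin_symmetric (polytope swapped_form).
Proof.
apply: (@origin_symmetric_polytope _ _ _ _ flip) => j.
by rewrite /swapped_form box_form_flip -scaleN1r swap01Z scaleN1r.
Qed.

Lemma dual_curvature_swapped eta :
  axis_facet_weight q (ord0 : 'I_m.+2) c = axis_facet_weight q i1 c ->
  dual_curvature_measure q (polytope (box_form c : _ -> 'rV[R]_m.+2)) eta =
  dual_curvature_measure q (polytope swapped_form) eta.
Proof.
move=> E; rewrite !dual_curvature_polytope; last 4 first.
- exact: swapped_form_pos.
- exact: swapped_form_inj.
- exact: box_form_pos.
- exact: box_form_inj.
rewrite [LHS](reindex_inj (inv_inj swap_indexK)); apply: eq_bigr => j _.
by rewrite direction_swapped facet_weight_swapped (facet_weight_swap_index _ E).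
Qed.

Lemma truncated_box_neq_swapped : 1 <= c ->
  polytope (box_form c : _ -> 'rV[R]_m.+2) <> polytope swapped_form.
Proof.
move=> c1 KL.
(* The point [(2, -1, 0, ...)] lies in the box and has coordinate sum [1 <= c], so the truncation
   keeps it; its image under the exchange violates [|x_1| <= 1]. *)
pose p : 'rV[R]_m.+2 := 2 *: delta_mx ord0 ord0 - delta_mx ord0 i1.
have pE k : p ord0 k = 2 * (k == ord0)%:R - (k == i1)%:R by rewrite !mxE eqxx.
have : polytope (box_form c) p.
  apply/polytope_boxP => -[k|].
    rewrite dotp_facet_some pE /axis_weight.
    have [->|_] := eqVneq k ord0; first by rewrite /= subr0 mulr1 mulVf ?normr1// pnatr_eq0.
    by case: (k == i1); rewrite ?mulr0 mul1r sub0r ?oppr0 ?normr0// normrN1.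
  rewrite dotp_facet_none !pE eqxx /= mulr1 subr0 mulr0 sub0r (_ : 2 - 1 = 1 :> R); last by ring.
  by rewrite mulr1 gtr0_norm ?invr_gt0// invf_le1.
rewrite KL => /polytope_swapped /polytope_boxP /(_ (Some i1)).
rewrite dotp_facet_some axis_weight1 mul1r mxE tpermR pE eqxx /= mulr1 subr0.
by rewrite ger0_norm// leNgt ltr1n.
Qed.

End swapped_truncated_box.

(** * Distinct symmetric bodies with equal dual curvature measures *)

Theorem theorem1p2 (R : realType) (n : nat) (q : R) (hn : (2 <= n)%N)
    (hq : n%:R < q) :
  exists K L : set 'rV[R]_n,
    [/\ convex_body K /\ origin_symmetric K,
        convex_body L /\ origin_symmetric L,
        forall eta : set 'rV[R]_n, eta `<=` sphere R n -> measurable eta ->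
          dual_curvature_measure q K eta = dual_curvature_measure q L eta
      & K <> L].
Proof.
case: n hn hq => [|[|m]]// _ hq.
have [c /andP[c1 _] E] := exists_balanced_truncation hq.
have c0 : 0 < c by exact: lt_le_trans c1.
exists (polytope (box_form c)), (polytope (swapped_form c)); split.
- by split; [exact: convex_body_truncated_box | exact: origin_symmetric_truncated_box].
- by split; [exact: convex_body_swapped | exact: origin_symmetric_swapped].
- by move=> eta _ _; exact: dual_curvature_swapped.
- exact: truncated_box_neq_swapped.
Qed.
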